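(* Let $G$ be an arbitrary group and let $H$ be a quasi-Hopf algebra over a field $\Bbbk$. The assignments \[ H=\bigoplus_{g\in G}H_g\longmapsto\pi \qquad\text{and}\qquad \pi\longmapsto H=\bigoplus_{g\in G}H_g^\pi \] define a bijective correspondence between the set of faithful $G$-gradings of $H$ as a quasi-Hopf algebra and the set of $G$-grading morphisms $H\to\Bbbk[G]$. In the first assignment $\pi$ is the morphism given by $\pi(x_g)=\varepsilon(x_g)\zeta_g$ for all $x_g\in H_g$, and in the second $H=\bigoplus_{g\in G}H_g^\pi$ is the decomposition of $H$ into the weight spaces $H_g^\pi$ of $\pi$.
   Context: Conventions. $\Bbbk$ is a field; vector spaces, algebras and tensor products are over $\Bbbk$; algebras are unital and algebra (anti-)morphisms preserve units. Summation is suppressed: $\Delta(x)=x'\otimes x''$, $\Delta^{\mathrm{cop}}(x)=x''\otimes x'$, $\Phi=\Phi^{(1)}\otimes\Phi^{(2)}\otimes\Phi^{(3)}$, $\Phi^{-1}=\Phi^{(-1)}\otimes\Phi^{(-2)}\otimes\Phi^{(-3)}$. Quasi-Hopf algebras. A quasi-Hopf algebra is an algebra $H$ with algebra morphisms $\Delta\colon H\to H\otimes H$, $\varepsilon\colon H\to\Bbbk$, an invertible $\Phi\in H^{\otimes 3}$, an algebra anti-morphism $S\colon H\to H$ (not assumed bijective) and elements $\alpha,\beta\in H$ such that for all $x\in H$: $(1\otimes\Phi)(\mathrm{id}\otimes\Delta\otimes\mathrm{id})(\Phi)(\Phi\otimes1)=(\mathrm{id}\otimes\mathrm{id}\otimes\Delta)(\Phi)(\Delta\otimes\mathrm{id}\otimes\mathrm{id})(\Phi)$;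 $\Phi(\Delta\otimes\mathrm{id})(\Delta(x))=(\mathrm{id}\otimes\Delta)(\Delta(x))\Phi$; $(\mathrm{id}\otimes\varepsilon\otimes\mathrm{id})(\Phi)=1\otimes1$; $(\mathrm{id}\otimes\varepsilon)\Delta(x)=x=(\varepsilon\otimes\mathrm{id})\Delta(x)$; $S(x')\alpha x''=\varepsilon(x)\alpha$; $x'\beta S(x'')=\varepsilon(x)\beta$; $\Phi^{(1)}\beta S(\Phi^{(2)})\alpha\Phi^{(3)}=1=S(\Phi^{(-1)})\alpha\Phi^{(-2)}\beta S(\Phi^{(-3)})$. Throughout, $(\alpha,\beta)$ is normalized by $\varepsilon(\alpha)=\varepsilon(\beta)=1$. A morphism of quasi-Hopf algebras is an algebra morphism commuting with $\Delta,\varepsilon,S$ and carrying $\Phi,\alpha,\beta$ to $\Phi,\alpha,\beta$. Gradings. For a group $G$ with identity $e$, a $G$-grading of $H$ as a quasi-Hopf algebra is a vector space decomposition $H=\bigoplus_{g\in G}H_g$ such that $H_gH_h\subseteq H_{gh}$, $\Delta(H_g)\subseteq H_g\otimes H_g$, $S(H_g)\subseteq H_{g^{-1}}$, $\Phi\in H_e^{\otimes3}$, $\alpha,\beta\in H_e$. It is faithful if $H_g\neq0$ for all $g$. The group algebra $\Bbbk[G]$ has basis $\{\zeta_g\}_{g\in G}$, $\zeta_g\zeta_h=\zeta_{gh}$, and is a Hopf algebra with every $\zeta_g$ group-like, viewed as a quasi-Hopf algebra with $\Phi=1\otimes1\otimes1$, $\alpha=\beta=1$. Drinfeld twist. The Drinfeld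 twist of $H$ is the invertible element $\mathfrak f\in H\otimes H$ given by \[ \mathfrak f=(S\otimes S)\left(\Delta^{\mathrm{cop}}(\Phi^{(-1)})\right)\,\gamma_0\,\Delta\left(\Phi^{(-2)}\beta S(\Phi^{(-3)})\right),\qquad \gamma_0=S(A^2)\alpha A^3\otimes S(A^1)\alpha A^4, \] with $A^1\otimes A^2\otimes A^3\otimes A^4=(\Phi\otimes1)(\Delta\otimes\mathrm{id}\otimes\mathrm{id})(\Phi^{-1})$; it satisfies $\mathfrak f\Delta(S(x))\mathfrak f^{-1}=(S\otimes S)(\Delta^{\mathrm{cop}}(x))$ for all $x\in H$ and $(\varepsilon\otimes\mathrm{id})(\mathfrak f)=1=(\mathrm{id}\otimes\varepsilon)(\mathfrak f)$. Grading morphisms. A morphism of quasi-Hopf algebras $\pi\colon H\to\Bbbk[G]$ is cocentral if $x'\otimes\pi(x'')=x''\otimes\pi(x')$ for all $x\in H$. Its weight spaces are $H_g^\pi=\{x\in H\mid(\pi\otimes\mathrm{id})\Delta(x)=\zeta_g\otimes x\}$, $g\in G$. A $G$-grading morphism is a cocentral morphism of quasi-Hopf algebras $\pi\colon H\to\Bbbk[G]$ that is surjective and satisfies $\Phi\in(H_e^\pi)^{\otimes3}$, $\alpha,\beta\in H_e^\pi$ and $\mathfrak f\in(H_e^\pi)^{\otimes2}$. *)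

(* Defs.v *)
From HB Require Import structures.
From mathcomp Require Import all_boot all_algebra.
From mathcomp Require Import boolp classical_sets.
From mathcomp Require Import finmap.
From mathcomp.multinomials Require Import monalg.

Set Implicit Arguments.
Unset Strict Implicit.
Unset Printing Implicit Defensive.

Import GRing.Theory.
Local Open Scope classical_set_scope.
Local Open Scope ring_scope.
Local Open Scope quotient_scope.

Section LinearFacts.
Variables (k : fieldType).

Lemma linP (U V : lmodType k) (f : U -> V) : linear f ->
  [/\ f 0 = 0, forall x y, f (x + y) = f x + f y
    & forall a x, f (a *: x) = a *: f x].
Proof.
move=> lf.
have f0 : f 0 = 0.
  have := lf (-1) 0 0; rewrite !scaleN1r addNr => ->; exact: addNr.
split => // [x y|a x]; first by have := lf 1 x y; rewrite !scale1r.
by have := lf a x 0; rewrite f0 !addr0.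
Qed.

Lemma lin_sum (U V : lmodType k) (f : U -> V) I (r : seq I) (F : I -> U) :
  linear f -> f (\sum_(i <- r) F i) = \sum_(i <- r) f (F i).
Proof. by case/linP => f0 fD _; apply: big_morph. Qed.

Lemma lin_comp (U V W : lmodType k) (g : V -> W) (f : U -> V) :
  linear g -> linear f -> linear (fun x => g (f x)).
Proof. by move=> lg lf a x y; rewrite lf lg. Qed.

Lemma lin_id (U : lmodType k) : linear (fun x : U => x).
Proof. by []. Qed.

Lemma lin_can (U V : lmodType k) (f : {linear U -> V}) : linear f.
Proof. exact: linearP. Qed.

(* A vector v != 0 has nonzero value under some linear form: take a subspace
   maximal among those avoiding v; it is a hyperplane. *)
Lemma exists_form (V : lmodType k) (v : V) : v != 0 ->
  exists f : V -> k^o, linear f /\ f v = 1.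
Proof.
move=> v0.
pose P (A : set V) := (forall a x y, A x -> A y -> A (a *: x + y)) /\ ~ A v.
have [F FP totF|A [[Alin Av] Amax]] := @Zorn_bigcup V P.
  split=> [a x y [A FA Ax] [B FB By]|[A FA Av]]; last exact: (FP _ FA).2 Av.
  have [AB|BA] := totF _ _ FA FB.
    by exists B => //; apply: (FP _ FB).1 => //; apply: AB.
  by exists A => //; apply: (FP _ FA).1 => //; apply: BA.
have A0 : A 0.
  case: (pselect (exists x, A x)) => [[x Ax]|nA].
    by have := Alin (-1) _ _ Ax Ax; rewrite scaleN1r addNr.
  exfalso; apply: (Amax [set 0] _ _); last first.
    split=> [a x y -> ->|/= /eqP]; first by rewrite /= scaler0 addr0.
    by rewrite (negPf v0).
  by split=> [x Ax|/(_ 0 erefl) A0]; case: nA; [exists x|exists 0].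
have AZ a x : A x -> A (a *: x) by move=> Ax; rewrite -[_ *: _]addr0; apply: Alin.
have AD x y : A x -> A y -> A (x + y).
  by move=> Ax Ay; rewrite -[x]scale1r; apply: Alin.
have AB x y : A x -> A y -> A (x - y).
  by move=> Ax Ay; rewrite -scaleN1r addrC; apply: Alin.
have ex x : exists c : k^o, A (x - c *: v).
  case: (pselect (A x)) => Ax; first by exists 0; rewrite scale0r subr0.
  pose B : set V := [set z | exists y c, A y /\ z = y + c *: x].
  have : ~ P B.
    apply: Amax; split=> [y Ay|BA]; first by exists y, 0; rewrite scale0r addr0.
    by apply/Ax/BA; exists 0, 1; rewrite scale1r add0r.
  move=> nPB; have [y [c [Ay vE]]] : B v.
    apply: contrapT => nBv; apply: nPB; split=> // a x1 x2 [y [c [Ay ->]]].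
    move=> [z [d [Az ->]]]; exists (a *: y + z), (a * c + d).
    by split; [exact: Alin|rewrite scalerDr scalerA scalerDl addrACA].
  have c0 : c != 0 by apply/eqP => c0; apply: Av; rewrite vE c0 scale0r addr0.
  exists c^-1; rewrite vE scalerDr scalerA mulVf // scale1r opprD addrCA subrr.
  by rewrite addr0 -scaleN1r; apply/AZ/AZ.
have uniq c d : A (c *: v - d *: v) -> c = d.
  move=> Acd; apply/eqP; rewrite -subr_eq0; apply/negP => /negP cd.
  by apply: Av; rewrite -[v]scale1r -(mulVf cd) -scalerA scalerBl; apply: AZ.
have [f fP] := choice ex.
exists f; split=> [a x y|]; apply: uniq; last first.
  have := fP v; rewrite -[X in X - _]scale1r => /(AZ (-1)).
  by rewrite scaleN1r opprB.
rewrite scalerDl -[a *: f x]/(a * f x) -scalerA.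
have := AB _ _ (AD _ _ (AZ a _ (fP x)) (fP y)) (fP (a *: x + y)).
set p := a *: x + y; set q := f p *: v.
by rewrite scalerBr addrACA -/p -opprD opprB (addrC (p - _)) addrA subrK.
Qed.

End LinearFacts.

(* Tensor product of vector spaces.  Its elements are classes of formal sums
   v_1 (x) w_1 + .. + v_n (x) w_n (lists of pairs); two formal sums are
   identified when every bilinear map takes the same value on them.  See tliftE,
   tlift_lin and tens_ext for the universal property. *)
Section Tensor.
Variables (k : fieldType) (V W : lmodType k).

Definition tsum (U : nmodType) (f : V -> W -> U) (s : seq (V * W)) : U :=
  \sum_(p <- s) f p.1 p.2.

Definition teq (s t : seq (V * W)) : bool :=
  `[< forall (U : lmodType k) (f : {bilinear V -> W -> U}), tsum f s = tsum f t >].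

Fact teq_equiv : equiv_class_of teq.
Proof.
split=> [s|s t|t s u] /=; first exact/asboolP.
  by apply/asboolP/asboolP => h U f; rewrite h.
by move=> /asboolP st /asboolP tu; apply/asboolP => U f; rewrite st tu.
Qed.

Canonical teq_rel := EquivRelPack teq_equiv.

Definition tensor := {eq_quot teq_rel}.
HB.instance Definition _ := Choice.on tensor.
HB.instance Definition _ := EqQuotient.on tensor.

(* tlift f (sum_i v_i (x) w_i) = sum_i f v_i w_i.  Total, but independent of the
   chosen representative only for bilinear f.  In Sweedler notation,
   tlift (fun a b => F a b) (Delta x) is F x' x''. *)
Definition tlift (U : nmodType) (f : V -> W -> U) (t : tensor) : U :=
  tsum f (repr t).

Definition bilin (U : lmodType k) (f : V -> W -> U) : Prop :=
  bilinear_for *:%R *:%R f.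

Definition tens (v : V) (w : W) : tensor := \pi_tensor [:: (v, w)].

Lemma bilin_can (U : lmodType k) (f : {bilinear V -> W -> U}) : bilin f.
Proof. by split=> u a x y /=; rewrite ?linearPl ?linearPr. Qed.

Lemma bilinW (U : lmodType k) (f : V -> W -> U) : bilin f ->
  exists g : {bilinear V -> W -> U}, f = g.
Proof.
move=> hf; pose m := bilinear_isBilinear.Build k V W U *:%R *:%R f hf.
pose g : {bilinear V -> W -> U} := HB.pack f m.
by exists g.
Qed.

Lemma tlift_pi (U : lmodType k) (f : V -> W -> U) s :
  bilin f -> tlift f (\pi_tensor s) = tsum f s.
Proof.
move=> /bilinW[{}f ->]; have : \pi_tensor (repr (\pi_tensor s)) = \pi_tensor s.
  by rewrite reprK.
by move/eqmodP/asboolP => h; apply: h.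
Qed.

Lemma tliftE (U : lmodType k) (f : V -> W -> U) v w :
  bilin f -> tlift f (tens v w) = f v w.
Proof. by move=> hf; rewrite tlift_pi // /tsum big_seq1. Qed.

Lemma tensor_eq (x y : tensor) :
  (forall (U : lmodType k) (f : V -> W -> U), bilin f -> tlift f x = tlift f y) ->
  x = y.
Proof.
move=> h; rewrite -[x]reprK -[y]reprK; apply/eqmodP/asboolP => U f.
exact/h/bilin_can.
Qed.

Definition tadd (x y : tensor) : tensor := \pi_tensor (repr x ++ repr y).
Definition tscale (a : k) (x : tensor) : tensor :=
  \pi_tensor [seq (a *: p.1, p.2) | p <- repr x].
Definition tzero : tensor := \pi_tensor [::].
Definition topp (x : tensor) : tensor := tscale (-1) x.

Section TliftOp.
Variables (U : lmodType k) (f : V -> W -> U) (hf : bilin f).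
Lemma tlift_add x y : tlift f (tadd x y) = tlift f x + tlift f y.
Proof. by rewrite tlift_pi // /tsum big_cat. Qed.
Lemma tlift_scale a x : tlift f (tscale a x) = a *: tlift f x.
Proof.
rewrite tlift_pi // /tsum big_map /= scaler_sumr; apply: eq_bigr => p _ /=.
by have [_ _ ->] := linP (hf.1 p.2).
Qed.
Lemma tlift_zero : tlift f tzero = 0.
Proof. by rewrite tlift_pi // /tsum big_nil. Qed.
Lemma tlift_opp x : tlift f (topp x) = - tlift f x.
Proof. by rewrite tlift_scale scaleN1r. Qed.
End TliftOp.

Let tE := (tlift_add, tlift_scale, tlift_zero, tlift_opp).

Fact taddA : associative tadd.
Proof. by move=> x y z; apply: tensor_eq => U f hf; rewrite !tE // addrA. Qed.
Fact taddC : commutative tadd.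
Proof. by move=> x y; apply: tensor_eq => U f hf; rewrite !tE // addrC. Qed.
Fact tadd0 : left_id tzero tadd.
Proof. by move=> x; apply: tensor_eq => U f hf; rewrite !tE // add0r. Qed.
Fact taddN : left_inverse tzero topp tadd.
Proof. by move=> x; apply: tensor_eq => U f hf; rewrite !tE // addNr. Qed.

HB.instance Definition _ := GRing.isZmodule.Build tensor taddA taddC tadd0 taddN.

Fact tscaleA a b v : tscale a (tscale b v) = tscale (a * b) v.
Proof. by apply: tensor_eq => U f hf; rewrite !tE // scalerA. Qed.
Fact tscale1 : left_id 1 tscale.
Proof. by move=> x; apply: tensor_eq => U f hf; rewrite !tE // scale1r. Qed.
Fact tscaleDr : right_distributive tscale +%R.
Proof.
by move=> a x y; apply: tensor_eq => U f hf; rewrite !tE // scalerDr.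
Qed.
Fact tscaleDl v : {morph tscale^~ v : a b / a + b}.
Proof. by move=> a b; apply: tensor_eq => U f hf; rewrite !tE // scalerDl. Qed.

HB.instance Definition _ :=
  GRing.Zmodule_isLmodule.Build k tensor tscaleA tscale1 tscaleDr tscaleDl.

Lemma tlift_lin (U : lmodType k) (f : V -> W -> U) : bilin f -> linear (tlift f).
Proof. by move=> hf a x y; rewrite tlift_add // tlift_scale. Qed.

Lemma tens_bilin : bilin tens.
Proof.
by split=> u a x y; apply: tensor_eq => U f hf;
  rewrite tlift_lin // !tliftE // ?hf.1 ?hf.2.
Qed.

Lemma tensE (x : tensor) : x = \sum_(p <- repr x) tens p.1 p.2.
Proof.
apply: tensor_eq => U f hf; rewrite lin_sum; last exact: tlift_lin.
by apply: eq_bigr => p _; rewrite tliftE.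
Qed.

Lemma tens_ext (U : lmodType k) (f g : tensor -> U) :
  linear f -> linear g -> (forall v w, f (tens v w) = g (tens v w)) ->
  forall x, f x = g x.
Proof.
move=> lf lg fg x; rewrite [x]tensE !lin_sum //.
by apply: eq_bigr => p _; apply: fg.
Qed.

Lemma bilin_comp (U U' : lmodType k) (g : U -> U') (f : V -> W -> U) :
  linear g -> bilin f -> bilin (fun v w => g (f v w)).
Proof. by move=> lg hf; split=> u a x y /=; rewrite ?hf.1 ?hf.2 lg. Qed.

End Tensor.

Arguments tens {k V W} v w.
Arguments tlift {k V W U} f t.

Arguments tensor {k} (V W)%_type_scope.
Notation "V ⊗ W" := (tensor V W) (at level 40, left associativity) : type_scope.
Notation "v ⊗ w" := (tens v w) (at level 40, left associativity) : ring_scope.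

Section TensorMaps.
Variable k : fieldType.

Definition tmap (V V' W W' : lmodType k) (f : V -> V') (g : W -> W') :
  V ⊗ W -> V' ⊗ W' := tlift (fun v w => f v ⊗ g w).

Definition tassoc (U V W : lmodType k) : (U ⊗ V) ⊗ W -> U ⊗ (V ⊗ W) :=
  tlift (fun t w => tlift (fun u v => u ⊗ (v ⊗ w)) t).

Definition tswap (V W : lmodType k) : V ⊗ W -> W ⊗ V :=
  tlift (fun v w => w ⊗ v).

Definition tlift3 (V1 V2 V3 : lmodType k) (U : nmodType)
    (f : V1 -> V2 -> V3 -> U) : V1 ⊗ (V2 ⊗ V3) -> U :=
  tlift (fun v t => tlift (f v) t).

Definition tlift4 (V1 V2 V3 V4 : lmodType k) (U : nmodType)
    (f : V1 -> V2 -> V3 -> V4 -> U) : V1 ⊗ (V2 ⊗ (V3 ⊗ V4)) -> U :=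
  tlift (fun v t => tlift3 (f v) t).

(* The subspace A ⊗ B of V ⊗ W, for subspaces A of V and B of W. *)
Definition tsub (V W : lmodType k) (A : set V) (B : set W) : set (V ⊗ W) :=
  [set t | exists s : seq (V * W),
     (forall p, p \in s -> A p.1 /\ B p.2) /\ t = \sum_(p <- s) p.1 ⊗ p.2].

Lemma tens_linl (V W : lmodType k) (w : W) : linear (fun v : V => v ⊗ w).
Proof. exact: (tens_bilin V W).1. Qed.

Lemma tens_linr (V W : lmodType k) (v : V) : linear (fun w : W => v ⊗ w).
Proof. exact: (tens_bilin V W).2. Qed.

Lemma tlift_linf (V W U : lmodType k) (f g h : V -> W -> U) a t :
  (forall v w, f v w = a *: g v w + h v w) ->
  tlift f t = a *: tlift g t + tlift h t.
Proof.
move=> fE; rewrite /tlift /tsum scaler_sumr -big_split.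
by apply: eq_bigr => p _; apply: fE.
Qed.

Lemma tmap_bilin (V V' W W' : lmodType k) (f : V -> V') (g : W -> W') :
  linear f -> linear g -> bilin (fun v w => f v ⊗ g w).
Proof. by move=> lf lg; split=> u a x y /=; rewrite ?lf ?lg ?tens_linl ?tens_linr. Qed.

Lemma tmap_lin (V V' W W' : lmodType k) (f : V -> V') (g : W -> W') :
  linear f -> linear g -> linear (tmap f g).
Proof. by move=> lf lg; apply/tlift_lin/tmap_bilin. Qed.

Lemma tmapE (V V' W W' : lmodType k) (f : V -> V') (g : W -> W') v w :
  linear f -> linear g -> tmap f g (v ⊗ w) = f v ⊗ g w.
Proof. by move=> lf lg; rewrite [LHS]tliftE //; apply: tmap_bilin. Qed.

Lemma tswap_bilin (V W : lmodType k) : bilin (fun (v : V) (w : W) => w ⊗ v).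
Proof. by split=> u a x y /=; rewrite ?tens_linl ?tens_linr. Qed.

Lemma tswap_lin (V W : lmodType k) : linear (@tswap V W).
Proof. exact/tlift_lin/tswap_bilin. Qed.

Lemma tswapE (V W : lmodType k) (v : V) (w : W) : tswap (v ⊗ w) = w ⊗ v.
Proof. by rewrite [LHS]tliftE //; apply: tswap_bilin. Qed.

Lemma tassoc_bilin (U V W : lmodType k) (w : W) :
  bilin (fun (u : U) (v : V) => u ⊗ (v ⊗ w)).
Proof. by split=> u a x y /=; rewrite ?tens_linl ?tens_linr. Qed.

Lemma tassoc_bilin2 (U V W : lmodType k) :
  bilin (fun (t : U ⊗ V) (w : W) => tlift (fun u v => u ⊗ (v ⊗ w)) t).
Proof.
split=> u a x y /=; first exact/tlift_lin/tassoc_bilin.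
by apply: tlift_linf => v w; rewrite !tens_linr.
Qed.

Lemma tassoc_lin (U V W : lmodType k) : linear (@tassoc U V W).
Proof. exact/tlift_lin/tassoc_bilin2. Qed.

Definition trilin (V1 V2 V3 U : lmodType k) (f : V1 -> V2 -> V3 -> U) : Prop :=
  (forall v, bilin (f v)) /\ (forall w x, linear (fun v => f v w x)).

Lemma tlift3_bilin (V1 V2 V3 U : lmodType k) (f : V1 -> V2 -> V3 -> U) :
  trilin f -> bilin (fun v t => tlift (f v) t).
Proof.
move=> [f23 f1]; split=> [t a x y|v]; last exact/tlift_lin.
by apply: tlift_linf => v w; rewrite f1.
Qed.

Lemma tlift3_lin (V1 V2 V3 U : lmodType k) (f : V1 -> V2 -> V3 -> U) :
  trilin f -> linear (tlift3 f).
Proof. by move=> hf; apply/tlift_lin/tlift3_bilin. Qed.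

Lemma tlift3E (V1 V2 V3 U : lmodType k) (f : V1 -> V2 -> V3 -> U) v w x :
  trilin f -> tlift3 f (v ⊗ (w ⊗ x)) = f v w x.
Proof.
move=> hf; rewrite [LHS]tliftE; last exact: tlift3_bilin.
by rewrite tliftE //; case: hf.
Qed.

Lemma tassocE (U V W : lmodType k) (u : U) (v : V) (w : W) :
  tassoc (u ⊗ v ⊗ w) = u ⊗ (v ⊗ w).
Proof.
rewrite [LHS]tliftE; last exact: tassoc_bilin2.
by rewrite tliftE //; apply: tassoc_bilin.
Qed.

End TensorMaps.

Section TensorAlgebra.
Variables (k : fieldType) (A B : algType k).

Definition tone : A ⊗ B := 1 ⊗ 1.
Definition tmul (x y : A ⊗ B) : A ⊗ B :=
  tlift (fun a b => tlift (fun c d => (a * c) ⊗ (b * d)) y) x.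

Let inner_bilin (a : A) (b : B) : bilin (fun c d => (a * c) ⊗ (b * d)).
Proof.
by split=> u s x y /=; rewrite mulrDr -scalerAr ?tens_linl ?tens_linr.
Qed.

Let outer_bilin (y : A ⊗ B) :
  bilin (fun a b => tlift (fun c d => (a * c) ⊗ (b * d)) y).
Proof.
by split=> u s x z /=; apply: tlift_linf => c d;
  rewrite mulrDl -scalerAl ?tens_linl ?tens_linr.
Qed.

Lemma tmul_linl y : linear (tmul^~ y).
Proof. exact: tlift_lin. Qed.

Lemma tmul_linr x : linear (tmul x).
Proof. by move=> a y z; apply: tlift_linf => u v; apply: tlift_lin. Qed.

Lemma tmulE a b c d : tmul (a ⊗ b) (c ⊗ d) = (a * c) ⊗ (b * d).
Proof. by rewrite [LHS]tliftE // tliftE. Qed.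

Fact tmulA : associative tmul.
Proof.
move=> x y z; move: x; apply: tens_ext.
- exact: tmul_linl.
- by move=> s u v; rewrite !tmul_linl.
move=> a b; move: y; apply: tens_ext.
- by move=> s u v; rewrite tmul_linl tmul_linr.
- by move=> s u v; rewrite tmul_linr tmul_linl.
move=> c d; move: z; apply: tens_ext.
- by move=> s u v; rewrite !tmul_linr.
- exact: tmul_linr.
by move=> e f; rewrite !tmulE !mulrA.
Qed.

Fact tmul1 : left_id tone tmul.
Proof.
apply: tens_ext; [exact: tmul_linr|by []|].
by move=> a b; rewrite tmulE !mul1r.
Qed.

Fact tmulr1 : right_id tone tmul.
Proof.
apply: tens_ext; [exact: tmul_linl|by []|].
by move=> a b; rewrite tmulE !mulr1.
Qed.

Fact tmulDl : left_distributive tmul +%R.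
Proof. by move=> x y z; have [_ -> _] := linP (tmul_linl z). Qed.

Fact tmulDr : right_distributive tmul +%R.
Proof. by move=> x y z; have [_ -> _] := linP (tmul_linr x). Qed.

Fact tone_neq0 : tone != 0.
Proof.
have [f [lf f1]] := exists_form (oner_neq0 A).
have [g [lg g1]] := exists_form (oner_neq0 B).
have hb : bilin (fun a b => f a * g b : k^o).
  split=> u s x y /=; rewrite ?lf ?lg.
    by rewrite mulrDl -scalerAl.
  by rewrite mulrDr -scalerAr.
apply/eqP => /(congr1 (tlift (fun a b => f a * g b : k^o))).
have [-> _ _] := linP (tlift_lin hb).
by rewrite tliftE // f1 g1 mulr1 => /eqP; rewrite oner_eq0.
Qed.

HB.instance Definition _ := GRing.Zmodule_isNzRing.Build (tensor A B)
  tmulA tmul1 tmulr1 tmulDl tmulDr tone_neq0.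

Fact tscaleAl a (x y : A ⊗ B) : a *: (x * y) = (a *: x) * y.
Proof. by have [_ _ h] := linP (tmul_linl y); apply/esym/h. Qed.

HB.instance Definition _ := GRing.Lmodule_isLalgebra.Build k (tensor A B) tscaleAl.

Fact tscaleAr a (x y : A ⊗ B) : a *: (x * y) = x * (a *: y).
Proof. by have [_ _ h] := linP (tmul_linr x); apply/esym/h. Qed.

HB.instance Definition _ := GRing.Lalgebra_isAlgebra.Build k (tensor A B) tscaleAr.

Lemma tensM (a c : A) (b d : B) : (a ⊗ b) * (c ⊗ d) = (a * c) ⊗ (b * d).
Proof. exact: tmulE. Qed.

End TensorAlgebra.

Section GroupAlgebra.
Variables (k : fieldType) (G : groupType).

Definition group_algebra : Type := {malg k[G]}.
HB.instance Definition _ := GRing.Lmodule.on group_algebra.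

Definition zeta (g : G) : group_algebra := << g >>.

(* Linear extension of a map defined on the basis (zeta g). *)
Definition zext (U : lmodType k) (f : G -> U) (x : group_algebra) : U :=
  \sum_(g <- msupp x) x@_g *: f g.

Lemma zext_lin (U : lmodType k) (f : G -> U) : linear (zext f).
Proof.
have w (D : {fset G}) (x : group_algebra) : (msupp x `<=` D)%fset ->
    zext f x = \sum_(g <- D) x@_g *: f g.
  move=> xD; rewrite /zext (big_fset_incl _ xD) // => g _ gx.
  by rewrite mcoeff_outdom // scale0r.
move=> a x y; pose D := (msupp (a *: x + y) `|` (msupp x `|` msupp y))%fset.
rewrite (w D (a *: x + y)) ?fsubsetUl //.
rewrite (w D x) /D; last by rewrite fsubsetU // fsubsetUl orbT.
rewrite (w D y) /D; last by rewrite fsubsetU // fsubsetUr orbT.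
rewrite scaler_sumr -big_split; apply: eq_bigr => g _.
by rewrite mcoeffD mcoeffZ scalerDl scalerA.
Qed.

Lemma zextE (U : lmodType k) (f : G -> U) g : zext f (zeta g) = f g.
Proof.
rewrite /zext /zeta msuppU oner_eq0 big_seq_fset1 mcoeffUU.
exact: scale1r.
Qed.

Lemma zeta_ext (U : lmodType k) (f h : group_algebra -> U) :
  linear f -> linear h -> (forall g, f (zeta g) = h (zeta g)) ->
  forall x, f x = h x.
Proof.
move=> lf lh fh x.
have -> : x = \sum_(g <- msupp x) x@_g *: zeta g.
  rewrite {1}[x]monalgE; apply: eq_bigr => g _.
  apply/malgP => h'; rewrite [RHS]mcoeffZ !mcoeffU.
  by case: eqP; rewrite ?mulr1n ?mulr0n ?mulr1 ?mulr0.
rewrite !lin_sum //; apply: eq_bigr => g _.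
by have [_ _ ->] := linP lf; have [_ _ ->] := linP lh; rewrite fh.
Qed.

Definition zmul (x y : group_algebra) : group_algebra :=
  zext (fun g => zext (fun h => zeta (g * h)%g) y) x.

Lemma zmul_linl y : linear (zmul^~ y).
Proof. exact: zext_lin. Qed.

Lemma zmul_linr x : linear (zmul x).
Proof.
move=> a y z; rewrite /zmul /zext scaler_sumr -big_split; apply: eq_bigr => g _.
by rewrite -!/(zext _ _) zext_lin scalerDr !scalerA mulrC.
Qed.

Lemma zmulE g h : zmul (zeta g) (zeta h) = zeta (g * h)%g.
Proof. by rewrite /zmul !zextE. Qed.

Fact zmulA : associative zmul.
Proof.
move=> x y z; move: x; apply: zeta_ext; [exact: zmul_linl| |].
  by move=> s u v; rewrite !zmul_linl.
move=> a; move: y; apply: zeta_ext.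
- by move=> s u v; rewrite zmul_linl zmul_linr.
- by move=> s u v; rewrite zmul_linr zmul_linl.
move=> b; move: z; apply: zeta_ext; [|exact: zmul_linr|].
  by move=> s u v; rewrite !zmul_linr.
by move=> c; rewrite !zmulE mulgA.
Qed.

Fact zmul1 : left_id (zeta 1%g) zmul.
Proof.
by apply: zeta_ext; [exact: zmul_linr|by []|] => g; rewrite zmulE mul1g.
Qed.

Fact zmulr1 : right_id (zeta 1%g) zmul.
Proof.
by apply: zeta_ext; [exact: zmul_linl|by []|] => g; rewrite zmulE mulg1.
Qed.

Fact zmulDl : left_distributive zmul +%R.
Proof. by move=> x y z; have [_ -> _] := linP (zmul_linl z). Qed.

Fact zmulDr : right_distributive zmul +%R.
Proof. by move=> x y z; have [_ -> _] := linP (zmul_linr x). Qed.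

Fact zeta1_neq0 : zeta 1%g != 0.
Proof.
apply/eqP => /(congr1 (mcoeff 1%g)) /eqP.
by rewrite mcoeffUU mcoeff0 oner_eq0.
Qed.

HB.instance Definition _ := GRing.Zmodule_isNzRing.Build group_algebra
  zmulA zmul1 zmulr1 zmulDl zmulDr zeta1_neq0.

Fact zscaleAl a (x y : group_algebra) : a *: (x * y) = (a *: x) * y.
Proof. by have [_ _ h] := linP (zmul_linl y); apply/esym/h. Qed.

HB.instance Definition _ := GRing.Lmodule_isLalgebra.Build k group_algebra zscaleAl.

Fact zscaleAr a (x y : group_algebra) : a *: (x * y) = x * (a *: y).
Proof. by have [_ _ h] := linP (zmul_linr x); apply/esym/h. Qed.

HB.instance Definition _ := GRing.Lalgebra_isAlgebra.Build k group_algebra zscaleAr.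

Lemma zetaM g h : zeta g * zeta h = zeta (g * h)%g.
Proof. exact: zmulE. Qed.

End GroupAlgebra.

Arguments zeta k {G} g.

(* H^{⊗3} and H^{⊗4} are bracketed to the right; the maps below include the
   reassociations that this requires. *)
Section LegMaps.
Variables (k : fieldType) (A : algType k) (D : A -> A ⊗ A).

Definition tensr1 (t : A ⊗ (A ⊗ A)) : A ⊗ (A ⊗ (A ⊗ A)) :=
  tmap idfun (tmap idfun (fun c => c ⊗ 1)) t.

Definition D_id (t : A ⊗ A) : A ⊗ (A ⊗ A) := tassoc (tmap D idfun t).

Definition id_D (t : A ⊗ A) : A ⊗ (A ⊗ A) := tmap idfun D t.

Definition D_id_id (t : A ⊗ (A ⊗ A)) : A ⊗ (A ⊗ (A ⊗ A)) :=
  tassoc (tmap D idfun t).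

Definition id_D_id (t : A ⊗ (A ⊗ A)) : A ⊗ (A ⊗ (A ⊗ A)) := tmap idfun D_id t.

Definition id_id_D (t : A ⊗ (A ⊗ A)) : A ⊗ (A ⊗ (A ⊗ A)) := tmap idfun id_D t.

Hypothesis D_lin : linear D.

Lemma D_id_lin : linear D_id.
Proof. by apply/lin_comp/tmap_lin => //; apply: tassoc_lin. Qed.

Lemma id_D_lin : linear id_D.
Proof. exact: tmap_lin. Qed.

Lemma D_idE a b : D_id (a ⊗ b) = tassoc (D a ⊗ b).
Proof. by rewrite /D_id tmapE. Qed.

Lemma id_DE a b : id_D (a ⊗ b) = a ⊗ D b.
Proof. exact: tmapE. Qed.

Lemma tensr1E a b c : tensr1 (a ⊗ (b ⊗ c)) = a ⊗ (b ⊗ (c ⊗ 1)).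
Proof. by rewrite /tensr1 !tmapE //; [exact: tens_linl|apply/tmap_lin/tens_linl]. Qed.

Lemma D_id_idE a t : D_id_id (a ⊗ t) = tassoc (D a ⊗ t).
Proof. by rewrite /D_id_id tmapE. Qed.

Lemma id_D_idE a t : id_D_id (a ⊗ t) = a ⊗ D_id t.
Proof. by apply: tmapE => //; apply: D_id_lin. Qed.

Lemma id_id_DE a t : id_id_D (a ⊗ t) = a ⊗ id_D t.
Proof. by apply: tmapE => //; apply: id_D_lin. Qed.

Hypothesis D1 : D 1 = 1.

Lemma tensr1_1 : tensr1 1 = 1.
Proof. exact: (tensr1E 1 1 1). Qed.

Lemma D_id_1 : D_id 1 = 1.
Proof. by rewrite [LHS](D_idE 1 1) D1; apply: tassocE. Qed.

Lemma id_D_1 : id_D 1 = 1.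
Proof. by rewrite [LHS](id_DE 1 1) D1. Qed.

Lemma D_id_id_1 : D_id_id 1 = 1.
Proof. by rewrite [LHS](D_id_idE 1 1) D1; apply: tassocE. Qed.

Lemma id_D_id_1 : id_D_id 1 = 1.
Proof. by rewrite [LHS](id_D_idE 1 1) D_id_1. Qed.

Lemma id_id_D_1 : id_id_D 1 = 1.
Proof. by rewrite [LHS](id_id_DE 1 1) id_D_1. Qed.

End LegMaps.

Record quasiHopf (k : fieldType) := QuasiHopf {
  qh_alg :> algType k;
  qDelta : {lrmorphism qh_alg -> qh_alg ⊗ qh_alg};
  qeps : {lrmorphism qh_alg -> k | *%R};
  qPhi : qh_alg ⊗ (qh_alg ⊗ qh_alg);
  qPhiV : qh_alg ⊗ (qh_alg ⊗ qh_alg);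
  qS : {linear qh_alg -> qh_alg};
  qalpha : qh_alg;
  qbeta : qh_alg;
  qPhiK : qPhi * qPhiV = 1;
  qPhiVK : qPhiV * qPhi = 1;
  qS1 : qS 1 = 1;
  qSM : forall x y, qS (x * y) = qS y * qS x;
  qpentagon : (1 ⊗ qPhi) * id_D_id qDelta qPhi * tensr1 qPhi
              = id_id_D qDelta qPhi * D_id_id qDelta qPhi;
  qcoassoc : forall x, qPhi * D_id qDelta (qDelta x)
                       = id_D qDelta (qDelta x) * qPhi;
  qPhi_eps : tlift3 (fun a b c => qeps b *: (a ⊗ c)) qPhi = 1 ⊗ 1;
  qcounitr : forall x, tlift (fun a b => qeps b *: a) (qDelta x) = x;
  qcounitl : forall x, tlift (fun a b => qeps a *: b) (qDelta x) = x;
  qantipl : forall x,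
    tlift (fun a b => qS a * qalpha * b) (qDelta x) = qeps x *: qalpha;
  qantipr : forall x,
    tlift (fun a b => a * qbeta * qS b) (qDelta x) = qeps x *: qbeta;
  qzigzag : tlift3 (fun a b c => a * qbeta * qS b * qalpha * c) qPhi = 1;
  qzigzagV : tlift3 (fun a b c => qS a * qalpha * b * qbeta * qS c) qPhiV = 1;
  qeps_alpha : qeps qalpha = 1;
  qeps_beta : qeps qbeta = 1
}.

Arguments qDelta {k q}.
Arguments qeps {k q}.
Arguments qPhi {k q}.
Arguments qPhiV {k q}.
Arguments qS {k q}.
Arguments qalpha {k q}.
Arguments qbeta {k q}.

Record qh_morphism (k : fieldType) (H K : quasiHopf k) (f : H -> K) : Prop := {
  qhm_linear : linear f;
  qhm_mult : GRing.monoid_morphism f;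
  qhm_Delta : forall x, qDelta (f x) = tmap f f (qDelta x);
  qhm_eps : forall x, qeps (f x) = qeps x;
  qhm_S : forall x, qS (f x) = f (qS x);
  qhm_Phi : tmap f (tmap f f) qPhi = qPhi;
  qhm_alpha : f qalpha = qalpha;
  qhm_beta : f qbeta = qbeta
}.

Section Drinfeld.
Variables (k : fieldType) (H : quasiHopf k).

Definition drinfeld_A : H ⊗ (H ⊗ (H ⊗ H)) :=
  tensr1 qPhi * D_id_id qDelta qPhiV.

Definition drinfeld_gamma0 : H ⊗ H :=
  tlift4 (fun a1 a2 a3 a4 => (qS a2 * qalpha * a3) ⊗ (qS a1 * qalpha * a4))
    drinfeld_A.

Definition drinfeld_twist : H ⊗ H :=
  tlift3 (fun a b c => tmap qS qS (tswap (qDelta a)) * drinfeld_gamma0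
                       * qDelta (b * qbeta * qS c)) qPhiV.

End Drinfeld.

Section GroupAlgebraHopf.
Variables (k : fieldType) (G : groupType).
Local Notation kG := (group_algebra k G).
Local Notation zeta := (@zeta k G).

Definition zDelta : kG -> kG ⊗ kG := zext (fun g => zeta g ⊗ zeta g).
Definition zeps : kG -> k := @zext k G k^o (fun=> 1).
Definition zS : kG -> kG := zext (fun g => zeta g^-1%g).

Let zD_lin : linear zDelta. Proof. exact: zext_lin. Qed.
Let zS_lin : linear zS. Proof. exact: zext_lin. Qed.
Let ze_lin : linear (zeps : kG -> k^o). Proof. exact: zext_lin. Qed.
Let zDE g : zDelta (zeta g) = zeta g ⊗ zeta g. Proof. exact: zextE. Qed.
Let zSE g : zS (zeta g) = zeta g^-1%g. Proof. exact: zextE. Qed.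
Let zeE g : zeps (zeta g) = 1. Proof. exact: (@zextE k G k^o). Qed.

Fact zDelta_mult : GRing.monoid_morphism zDelta.
Proof.
split=> [|x y]; first exact: zDE.
move: x; apply: zeta_ext => [a u v|a u v|g].
- by rewrite mulrDl -scalerAl zD_lin.
- by rewrite zD_lin mulrDl -scalerAl.
move: y; apply: zeta_ext => [a u v|a u v|h].
- by rewrite mulrDr -scalerAr zD_lin.
- by rewrite zD_lin mulrDr -scalerAr.
by rewrite zetaM !zDE tensM zetaM.
Qed.

Fact zeps_mult : GRing.monoid_morphism zeps.
Proof.
split=> [|x y]; first exact: zeE.
move: x; apply: (@zeta_ext k G k^o) => [a u v|a u v|g].
- by rewrite mulrDl -scalerAl ze_lin.
- by rewrite ze_lin [LHS]mulrDl; congr (_ + _); apply/esym/mulrA.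
move: y; apply: (@zeta_ext k G k^o) => [a u v|a u v|h].
- by rewrite mulrDr -scalerAr ze_lin.
- by rewrite ze_lin [LHS]mulrDr; congr (_ + _); apply: mulrCA.
by rewrite zetaM !zeE mulr1.
Qed.

HB.instance Definition _ := GRing.isLinear.Build k kG (kG ⊗ kG)%type _ zDelta zD_lin.
HB.instance Definition _ :=
  GRing.isMonoidMorphism.Build kG (kG ⊗ kG)%type zDelta zDelta_mult.
HB.instance Definition _ := GRing.isLinear.Build k kG k *%R zeps ze_lin.
HB.instance Definition _ := GRing.isMonoidMorphism.Build kG k zeps zeps_mult.
HB.instance Definition _ := GRing.isLinear.Build k kG kG _ zS zS_lin.

Let z1 : zeta 1%g = 1. Proof. by []. Qed.
Let ze1 : zeps 1 = 1. Proof. exact: zeE. Qed.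
Let zS1 : zS 1 = 1. Proof. by rewrite -z1 zSE invg1. Qed.
Let zD1 : zDelta 1 = 1. Proof. exact: zDE. Qed.
Let t1 (A B : algType k) : (1 : A) ⊗ (1 : B) = 1. Proof. by []. Qed.

Fact zSM (x y : kG) : zS (x * y) = zS y * zS x.
Proof.
move: x; apply: zeta_ext => [a u v|a u v|g].
- by rewrite mulrDl -scalerAl zS_lin.
- by rewrite zS_lin mulrDr -scalerAr.
move: y; apply: zeta_ext => [a u v|a u v|h].
- by rewrite mulrDr -scalerAr zS_lin.
- by rewrite zS_lin mulrDl -scalerAl.
by rewrite zetaM !zSE zetaM invgM.
Qed.

Fact zpentagon : (1 ⊗ 1) * id_D_id zDelta 1 * tensr1 1
  = id_id_D zDelta 1 * D_id_id zDelta 1.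
Proof.
by rewrite id_D_id_1 // tensr1_1 id_id_D_1 // D_id_id_1 // t1 !mulr1.
Qed.

Fact zcoassoc (x : kG) :
  1 * D_id zDelta (zDelta x) = id_D zDelta (zDelta x) * 1.
Proof.
rewrite mul1r mulr1; move: x; apply: zeta_ext.
- exact/lin_comp/zD_lin/D_id_lin.
- exact/lin_comp/zD_lin/id_D_lin.
by move=> g; rewrite zDE D_idE // id_DE // zDE tassocE.
Qed.

Fact zPhi_eps :
  tlift3 (fun a b c : kG => zeps b *: (a ⊗ c)) (1 ⊗ (1 ⊗ 1)) = 1 ⊗ 1.
Proof.
rewrite tlift3E ?ze1 ?scale1r //; split=> [v|w x].
  split=> w a x y /=; rewrite ?tens_linr ?ze_lin.
    by rewrite scalerDl scalerA.
  by rewrite scalerDr !scalerA mulrC.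
by move=> a u v; rewrite tens_linl scalerDr !scalerA mulrC.
Qed.

Let scale_bilinr :
  bilin (fun a b : kG => zeps b *: a).
Proof.
split=> w a x y /=; first by rewrite scalerDr !scalerA mulrC.
by rewrite ze_lin scalerDl scalerA.
Qed.

Let scale_bilinl :
  bilin (fun a b : kG => zeps a *: b).
Proof.
split=> w a x y /=; last by rewrite scalerDr !scalerA mulrC.
by rewrite ze_lin scalerDl scalerA.
Qed.

Fact zcounitr x : tlift (fun a b : kG => zeps b *: a) (zDelta x) = x.
Proof.
move: x; apply: zeta_ext => [||g]; [exact/lin_comp/zD_lin/tlift_lin|by []|].
by rewrite zDE tliftE // zeE scale1r.
Qed.

Fact zcounitl x : tlift (fun a b : kG => zeps a *: b) (zDelta x) = x.
Proof.
move: x; apply: zeta_ext => [||g]; [exact/lin_comp/zD_lin/tlift_lin|by []|].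
by rewrite zDE tliftE // zeE scale1r.
Qed.

Let mul_linl (A : algType k) (y : A) : linear (fun x => x * y).
Proof. by move=> a u v; rewrite mulrDl -scalerAl. Qed.
Let mul_linr (A : algType k) (x : A) : linear (fun y => x * y).
Proof. by move=> a u v; rewrite mulrDr -scalerAr. Qed.
Let ze1_lin : linear (fun x => zeps x *: (1 : kG)).
Proof. by move=> a u v; rewrite ze_lin scalerDl scalerA. Qed.

Fact zantipl x : tlift (fun a b : kG => zS a * 1 * b) (zDelta x) = zeps x *: 1.
Proof.
have hb : bilin (fun a b : kG => zS a * 1 * b).
  by split=> w a u v; rewrite ?zS_lin ?mul_linl ?mul_linr.
move: x; apply: zeta_ext => [||g]; [exact/lin_comp/zD_lin/tlift_lin|by []|].
by rewrite zDE tliftE // zSE mulr1 zetaM mulVg zeE scale1r.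
Qed.

Fact zantipr x : tlift (fun a b : kG => a * 1 * zS b) (zDelta x) = zeps x *: 1.
Proof.
have hb : bilin (fun a b : kG => a * 1 * zS b).
  by split=> w a u v; rewrite ?zS_lin ?mul_linl ?mul_linr.
move: x; apply: zeta_ext => [||g]; [exact/lin_comp/zD_lin/tlift_lin|by []|].
by rewrite zDE tliftE // zSE mulr1 zetaM mulgV zeE scale1r.
Qed.

Fact zzigzag :
  tlift3 (fun a b c : kG => a * 1 * zS b * 1 * c) (1 ⊗ (1 ⊗ 1)) = 1.
Proof.
rewrite tlift3E; first by rewrite zS1 !mulr1.
split=> [v|w x]; first split=> [w|w].
- by do 2![apply/lin_comp; first exact: mul_linl]; apply/lin_comp/zS_lin/mul_linr.
- exact: mul_linr.
by do 3![apply/lin_comp; first exact: mul_linl]; apply: mul_linl.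
Qed.

Fact zzigzagV :
  tlift3 (fun a b c : kG => zS a * 1 * b * 1 * zS c) (1 ⊗ (1 ⊗ 1)) = 1.
Proof.
rewrite tlift3E; first by rewrite zS1 !mulr1.
split=> [v|w x]; first split=> [w|w].
- by do 2![apply/lin_comp; first exact: mul_linl]; apply: mul_linr.
- exact/lin_comp/zS_lin/mul_linr.
by do 4![apply/lin_comp; first exact: mul_linl]; apply: zS_lin.
Qed.

Definition group_quasiHopf : quasiHopf k :=
  @QuasiHopf k kG zDelta zeps (1 ⊗ (1 ⊗ 1)) (1 ⊗ (1 ⊗ 1)) zS 1 1
    (mulr1 _) (mulr1 _) zS1 zSM zpentagon zcoassoc zPhi_eps zcounitr zcounitl
    zantipl zantipr zzigzag zzigzagV ze1 ze1.

End GroupAlgebraHopf.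

Section Gradings.
Variables (k : fieldType) (G : groupType) (H : quasiHopf k).
Local Notation kG := (group_quasiHopf k G).

Definition subspace (V : lmodType k) (A : set V) : Prop :=
  A 0 /\ forall a x y, A x -> A y -> A (a *: x + y).

(* V is the internal direct sum of the subspaces F i. *)
Definition direct_sum (I : eqType) (V : lmodType k) (F : I -> set V) : Prop :=
  [/\ forall i, subspace (F i),
      forall x, exists (s : seq I) (c : I -> V),
        (forall i, F i (c i)) /\ x = \sum_(i <- s) c i
    & forall (s : seq I) (c : I -> V), uniq s -> (forall i, F i (c i)) ->
        \sum_(i <- s) c i = 0 -> forall i, i \in s -> c i = 0].

Record is_grading (F : G -> set H) : Prop := {
  gr_sum : direct_sum F;
  gr_mul : forall g h x y, F g x -> F h y -> F (g * h)%g (x * y);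
  gr_Delta : forall g x, F g x -> tsub (F g) (F g) (qDelta x);
  gr_S : forall g x, F g x -> F (g^-1)%g (qS x);
  gr_Phi : tsub (F 1%g) (tsub (F 1%g) (F 1%g)) qPhi;
  gr_alpha : F 1%g qalpha;
  gr_beta : F 1%g qbeta
}.

Definition faithful (F : G -> set H) : Prop :=
  forall g, exists2 x, F g x & x != 0.

Definition cocentral (pi : H -> kG) : Prop :=
  forall x, tmap idfun pi (qDelta x) = tmap idfun pi (tswap (qDelta x)).

Definition weight_space (pi : H -> kG) (g : G) : set H :=
  [set x | tmap pi idfun (qDelta x) = zeta k g ⊗ x].

Record is_grading_morphism (pi : H -> kG) : Prop := {
  gm_morphism : qh_morphism pi;
  gm_cocentral : cocentral pi;
  gm_surj : forall y, exists x, pi x = y;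
  gm_Phi : tsub (weight_space pi 1%g)
             (tsub (weight_space pi 1%g) (weight_space pi 1%g)) qPhi;
  gm_alpha : weight_space pi 1%g qalpha;
  gm_beta : weight_space pi 1%g qbeta;
  gm_twist : tsub (weight_space pi 1%g) (weight_space pi 1%g) (drinfeld_twist H)
}.

Definition faithful_grading := {F : G -> set H | is_grading F /\ faithful F}.

Definition grading_morphism := {f : H -> kG | is_grading_morphism f}.

End Gradings.

(* Main.v *)
(* A grading F gives pi x = eps x zeta_g on F g, whose weight spaces contain, hence
   equal, the F g.  Phi^-1 lies in (F 1)^{⊗3} because the projection onto F 1 is
   F 1-linear, so the Drinfeld twist, built from Phi, Phi^-1, alpha, beta, Delta
   and S, lies in F 1 ⊗ F 1.

   Conversely let rho = (pi ⊗ id) Delta.  As pi = eps on weight 1, (pi ⊗ pi ⊗ id) Phi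
   = 1, so rho is a genuine coaction of k[G] and H is the direct sum of its weight
   spaces; likewise quasi-coassociativity and cocentrality give
   Delta(H_g) ⊆ H_g ⊗ H_g.

   For S, write X ⊗ Y ⊗ Z = Phi^-1 and U = (1 ⊗ S(X) alpha) rho(Y beta S(Z)).
   Evaluating (zeta_{g^-1} ⊗ S(X x_1) alpha) rho(Y x_21 beta S(Z x_22)) for x in H_g
   with quasi-coassociativity and the antipode axioms yields
   (zeta_{g^-1} ⊗ S(x)) U = U rho(S(x)), as for the uniqueness of the antipode.
   The element U is (pi ⊗ id)(f), which is 1 because the twist f has weight 1. *)
Require Import Defs.
From HB Require Import structures.
From mathcomp Require Import all_boot all_algebra.
From mathcomp Require Import boolp classical_sets.

Set Implicit Arguments.
Unset Strict Implicit.
Unset Printing Implicit Defensive.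

Import GRing.Theory.
Local Open Scope classical_set_scope.
Local Open Scope ring_scope.

(** * Linear maps and tensor products *)

Section LinearMaps.
Variable k : fieldType.

Lemma mul_linl (A : algType k) (y : A) : linear (fun x => x * y).
Proof. by move=> a u v; rewrite mulrDl -scalerAl. Qed.

Lemma mul_linr (A : algType k) (x : A) : linear ( *%R x).
Proof. by move=> a u v; rewrite mulrDr -scalerAr. Qed.

Lemma scale_lin (V : lmodType k) (c : k) : linear (fun v : V => c *: v).
Proof. by move=> a u v; rewrite scalerDr !scalerA mulrC. Qed.

Lemma scale_linl (V : lmodType k) (v : V) : linear (fun c : k^o => (c : k) *: v).
Proof. by move=> a c d; rewrite scalerDl scalerA. Qed.

Lemma tensZl (V W : lmodType k) c (v : V) (w : W) : (c *: v) ⊗ w = c *: (v ⊗ w).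
Proof. by have [_ _ ->] := linP (@tens_linl _ V _ w). Qed.

Lemma tensZr (V W : lmodType k) c (v : V) (w : W) : v ⊗ (c *: w) = c *: (v ⊗ w).
Proof. by have [_ _ ->] := linP (@tens_linr _ _ W v). Qed.

(** [tlift] is a sum over one fixed representative of [t], so linearity in an outer parameter passes
    through term by term. *)
Lemma tlift_linfun (U V W X : lmodType k) (f : U -> V -> W -> X) t :
  (forall v w, linear (fun u => f u v w)) -> linear (fun u => tlift (f u) t).
Proof. by move=> lf a x y; apply: tlift_linf => v w; rewrite lf. Qed.

Lemma eps_lin (H : quasiHopf k) : linear (qeps : H -> k^o).
Proof. by move=> a x y; rewrite linearP. Qed.

Lemma eps_scale_lin (H : quasiHopf k) (V : lmodType k) (v : V) :
  linear (fun x : H => qeps x *: v).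
Proof. exact: (lin_comp (scale_linl v) (@eps_lin H)). Qed.

End LinearMaps.

(* Proves linearity of nested lambda terms by recursion on the head symbol;
   [lin_const] is the hook by which later linear maps are registered. *)
Ltac lin_const f := fail.

Ltac lin :=
  cbv beta;
  lazymatch goal with
  | |- bilin _ => split=> ?; lin
  | |- trilin _ => split=> [?|? ?]; lin
  | |- forall _, _ => intro; lin
  | |- GRing.linear_for _ (fun x => x) => exact: lin_id
  | |- GRing.linear_for _ (fun x => ?f x) => lin_fun f
  | |- GRing.linear_for _ (fun x => @?f x) => lin_body
  | |- GRing.linear_for _ ?f => lin_fun f
  end
with lin_body :=
  match goal with
  | |- GRing.linear_for _ (fun x => ?f (@?e x)) =>
      apply: (@lin_comp _ _ _ _ f e); [lin|lin]
  | |- GRing.linear_for _ (fun x => @tens _ _ _ (@?e x) ?b) =>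
      apply: (lin_comp (tens_linl b)); lin
  | |- GRing.linear_for _ (fun x => GRing.mul (@?e x) ?b) =>
      apply: (lin_comp (mul_linl b)); lin
  | |- GRing.linear_for _ (fun x => GRing.scale (@?e x) ?b) =>
      first [ apply: (lin_comp (eps_scale_lin b)) | apply: (lin_comp (scale_linl b)) ]; lin
  | |- GRing.linear_for _ (fun x => tlift _ _) =>
      apply: tlift_linfun => ? ?; lin
  end
with lin_fun f :=
  lazymatch f with
  | @tens _ _ _ _ => exact: tens_linr
  | GRing.mul _ => exact: mul_linr
  | GRing.scale _ => exact: scale_lin
  | @tassoc _ _ _ _ => exact: tassoc_lin
  | @tswap _ _ _ => exact: tswap_lin
  | tlift _ => apply: tlift_lin; lin
  | tlift3 _ => apply: tlift3_lin; lin
  | tmap _ _ => apply: tmap_lin; lin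
  | idfun => exact: lin_id
  | _ => first [ match goal with h : GRing.linear_for _ f |- _ => exact: h end
               | lin_const f | exact: eps_lin | exact: lin_can | assumption ]
  end.

(** * Subspaces of tensor products, and reduction to pure tensors *)

Section Subspaces.
Variable k : fieldType.

Lemma subspaceZ (V : lmodType k) (C : set V) a x : subspace C -> C x -> C (a *: x).
Proof. by move=> [C0 Cl] Cx; rewrite -[a *: x]addr0; apply: Cl. Qed.

Lemma subspaceD (V : lmodType k) (C : set V) x y :
  subspace C -> C x -> C y -> C (x + y).
Proof. by move=> [_ Cl] Cx Cy; rewrite -[x]scale1r; apply: Cl. Qed.

Lemma subspace_sum (V : lmodType k) (C : set V) (I : eqType) (s : seq I) (F : I -> V) :
  subspace C -> (forall i, i \in s -> C (F i)) -> C (\sum_(i <- s) F i).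
Proof.
move=> sC CF; rewrite big_seq; apply: big_ind => //; first by case: sC.
by move=> x y; apply: subspaceD.
Qed.

Lemma tsub_tens (V W : lmodType k) (A : set V) (B : set W) v w :
  A v -> B w -> tsub A B (v ⊗ w).
Proof.
move=> Av Bw; exists [:: (v, w)]; rewrite big_seq1; split=> // p.
by rewrite inE => /eqP ->.
Qed.

Lemma tsub_subspace (V W : lmodType k) (A : set V) (B : set W) :
  subspace A -> subspace (tsub A B).
Proof.
move=> sA; split; first by exists [::]; rewrite big_nil; split.
move=> a _ _ [s [sP ->]] [t [tP ->]].
exists ([seq (a *: p.1, p.2) | p <- s] ++ t); split.
  move=> p; rewrite mem_cat => /orP[/mapP[q /sP[Aq Bq] ->]|/tP //].
  by split=> //; apply: subspaceZ.
rewrite big_cat big_map /= scaler_sumr; congr (_ + _); apply: eq_bigr => p _.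
by rewrite tensZl.
Qed.

Lemma tsubT_l (V W : lmodType k) (A : set V) (B : set W) t :
  tsub A B t -> tsub A setT t.
Proof. by move=> [s [sP ->]]; exists s; split=> // p /sP[]. Qed.

Lemma tsubT_r (V W : lmodType k) (A : set V) (B : set W) t :
  tsub A B t -> tsub setT B t.
Proof. by move=> [s [sP ->]]; exists s; split=> // p /sP[]. Qed.

(** Elements of [tsub A B] are finite sums of pure tensors with legs in [A] and [B]; this lemma and
    [tsub_ext] allow leg-by-leg computation with homogeneous elements. *)
Lemma tsub_map (V W U : lmodType k) (A : set V) (B : set W) (C : set U)
    (f : V ⊗ W -> U) :
  subspace C -> linear f -> (forall v w, A v -> B w -> C (f (v ⊗ w))) ->
  forall t, tsub A B t -> C (f t).
Proof.
move=> sC lf fC _ [s [sP ->]]; rewrite lin_sum //.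
by apply: subspace_sum => // p /sP[]; apply: fC.
Qed.

Lemma tsub_ext (V W U : lmodType k) (A : set V) (B : set W) (f g : V ⊗ W -> U) :
  linear f -> linear g ->
  (forall v w, A v -> B w -> f (v ⊗ w) = g (v ⊗ w)) ->
  forall t, tsub A B t -> f t = g t.
Proof.
move=> lf lg fg _ [s [sP ->]]; rewrite !lin_sum //.
by rewrite big_seq [RHS]big_seq; apply: eq_bigr => p /sP[]; apply: fg.
Qed.

Lemma tsub_ext3 (V1 V2 V3 U : lmodType k) (A : set V1) (B : set V2) (C : set V3)
    (f g : V1 ⊗ (V2 ⊗ V3) -> U) :
  linear f -> linear g ->
  (forall u v w, A u -> B v -> C w -> f (u ⊗ (v ⊗ w)) = g (u ⊗ (v ⊗ w))) ->
  forall t, tsub A (tsub B C) t -> f t = g t.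
Proof.
move=> lf lg fg; apply: tsub_ext => // u t Au; move: t; apply: tsub_ext; [lin|lin|].
by move=> v w; apply: fg.
Qed.

Lemma tens_map (V W U : lmodType k) (C : set U) (f : V ⊗ W -> U) :
  subspace C -> linear f -> (forall v w, C (f (v ⊗ w))) -> forall t, C (f t).
Proof.
move=> sC lf fC t; rewrite [t]tensE lin_sum //.
by apply: subspace_sum => // p _; apply: fC.
Qed.

Lemma tens_ext3 (V1 V2 V3 U : lmodType k) (f g : V1 ⊗ (V2 ⊗ V3) -> U) :
  linear f -> linear g ->
  (forall u v w, f (u ⊗ (v ⊗ w)) = g (u ⊗ (v ⊗ w))) -> forall t, f t = g t.
Proof.
move=> lf lg fg; apply: tens_ext => // u; apply: tens_ext; [lin|lin|].
by move=> v w; apply: fg.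
Qed.

Lemma tmap_comp (V V' V'' W W' W'' : lmodType k) (f : V' -> V'') (g : W' -> W'')
    (f' : V -> V') (g' : W -> W') t :
  linear f -> linear g -> linear f' -> linear g' ->
  tmap f g (tmap f' g' t) = tmap (fun x => f (f' x)) (fun x => g (g' x)) t.
Proof.
move=> lf lg lf' lg'; move: t; apply: tens_ext; [lin|lin|] => v w.
by rewrite !tmapE //; lin.
Qed.

Lemma tmapM (A A' B B' : algType k) (f : A -> A') (g : B -> B') s t :
  linear f -> linear g ->
  (forall x y, f (x * y) = f x * f y) -> (forall x y, g (x * y) = g x * g y) ->
  tmap f g (s * t) = tmap f g s * tmap f g t.
Proof.
move=> lf lg fM gM; move: s; apply: tens_ext; [lin|lin|] => a b.
move: t; apply: tens_ext; [lin|lin|] => c d.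
by rewrite tensM !tmapE // tensM fM gM.
Qed.

Lemma tmap1 (A A' B B' : algType k) (f : A -> A') (g : B -> B') :
  linear f -> linear g -> f 1 = 1 -> g 1 = 1 -> tmap f g 1 = 1.
Proof. by move=> lf lg f1 g1; rewrite [LHS](tmapE 1 1 lf lg) f1 g1. Qed.

(** The pairs of sets are independent of each other, so the lemma iterates to higher tensor
    powers. *)
Lemma tensM_sub (A B : algType k) (X X' X'' : set A) (Y Y' Y'' : set B) :
  subspace X'' ->
  (forall x x', X x -> X' x' -> X'' (x * x')) ->
  (forall y y', Y y -> Y' y' -> Y'' (y * y')) ->
  forall s t, tsub X Y s -> tsub X' Y' t -> tsub X'' Y'' (s * t).
Proof.
move=> sX XM YM s t Xs Xt; have sT := tsub_subspace Y'' sX.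
move: s Xs; apply: (tsub_map sT); [lin|] => a b Xa Yb.
move: t Xt; apply: (tsub_map sT); [lin|] => c d Xc Yd.
by rewrite tensM; apply: tsub_tens; [apply: XM|apply: YM].
Qed.

End Subspaces.

(** * Direct sums *)

Section DirectSums.
Variables (k : fieldType) (I : eqType) (V : lmodType k) (F : I -> set V).
Hypothesis dF : direct_sum F.

Let sF i : subspace (F i). Proof. by case: dF. Qed.

Lemma dsum_ind (C : set V) :
  subspace C -> (forall i x, F i x -> C x) -> forall x, C x.
Proof.
move=> sC FC x; have [_ /(_ x)[s [c [Fc ->]]] _] := dF.
by apply: subspace_sum => // i _; apply/FC/Fc.
Qed.

Lemma dsum_ext (U : lmodType k) (f g : V -> U) :
  linear f -> linear g -> (forall i x, F i x -> f x = g x) -> forall x, f x = g x.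
Proof.
move=> lf lg fg x; have [_ /(_ x)[s [c [Fc ->]]] _] := dF.
by rewrite !lin_sum //; apply: eq_bigr => i _; apply/fg/Fc.
Qed.

(* The extension is the functional relation consisting of the pairs
   (sum_p p.2, sum_p phi p.1 p.2), for lists of pairs p = (i, v) with v in F i. *)
Lemma dsum_lift (U : lmodType k) (phi : I -> V -> U) :
  (forall i, linear (phi i)) ->
  exists f : V -> U, linear f /\ forall i x, F i x -> f x = phi i x.
Proof.
move=> lphi.
pose graded (l : seq (I * V)) := forall p, p \in l -> F p.1 p.2.
pose R x u := exists l, [/\ graded l, x = \sum_(p <- l) p.2
  & u = \sum_(p <- l) phi p.1 p.2].
have Rtot x : exists u, R x u.
  have [_ /(_ x)[s [c [Fc ->]]] _] := dF.
  exists (\sum_(i <- s) phi i (c i)), [seq (i, c i) | i <- s].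
  by split; [move=> _ /mapP[i _ ->]; apply: Fc|rewrite big_map..].
(* Single-valuedness at 0: grouping the list by index writes 0 as a sum of components, each of which
   vanishes by directness. *)
have R0 u : R 0 u -> u = 0.
  move=> [l [lF l0 ->]]; pose s := undup (map fst l).
  pose c i := \sum_(p <- l | p.1 == i) p.2.
  have group (W : nmodType) (h : I -> V -> W) :
      \sum_(p <- l) h p.1 p.2 = \sum_(i <- s) \sum_(p <- l | p.1 == i) h i p.2.
    rewrite (exchange_big_dep xpredT) //= [LHS]big_seq [RHS]big_seq.
    apply: eq_bigr => p pl.
    rewrite (big_rem p.1) /=; last by rewrite mem_undup map_f.
    rewrite eqxx big_seq_cond big1 ?addr0 // => i /andP[].
    by rewrite mem_rem_uniq ?undup_uniq // inE eq_sym => /andP[/negPf ->].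
  have Fc i : F i (c i).
    rewrite /c big_seq_cond; apply: (big_ind (F i)).
    - by case: (sF i).
    - by move=> x y; apply: subspaceD.
    by move=> p /andP[/lF Fp /eqP <-].
  have [_ _ /(_ s c (undup_uniq _) Fc)] := dF.
  rewrite -(group _ (fun _ v => v)) -l0 => /(_ erefl) c0.
  rewrite group big_seq big1 // => i /c0 ci.
  by rewrite -big_filter -lin_sum // big_filter -/(c i) ci; case: (linP (lphi i)).
have Rlin a x y u v : R x u -> R y v -> R (a *: x + y) (a *: u + v).
  move=> [l [lF -> ->]] [m [mF -> ->]].
  exists ([seq (p.1, a *: p.2) | p <- l] ++ m); split.
  - move=> p; rewrite mem_cat => /orP[/mapP[q /lF Fq ->]|/mF //].
    exact: subspaceZ.
  - by rewrite big_cat big_map scaler_sumr.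
  rewrite big_cat big_map scaler_sumr; congr (_ + _).
  by apply: eq_bigr => p _ /=; have [_ _ ->] := linP (lphi p.1).
have Rfun x u v : R x u -> R x v -> u = v.
  move=> Ru Rv; apply/eqP; rewrite -subr_eq0; apply/eqP/R0.
  by have := Rlin (-1) _ _ _ _ Rv Ru; rewrite !scaleN1r addNr addrC.
have [f fP] := choice Rtot.
exists f; split=> [a x y|i x Fx]; first exact: (Rfun _ _ _ (fP _) (Rlin _ _ _ _ _ (fP _) (fP _))).
apply: (Rfun x) => //; exists [:: (i, x)].
by split; rewrite ?big_seq1 // => p; rewrite inE => /eqP ->.
Qed.

Lemma dsum_proj (i : I) :
  exists P : V -> V, [/\ linear P, forall x, F i (P x), forall x, F i x -> P x = x
    & forall j x, j != i -> F j x -> P x = 0].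
Proof.
have [|P [lP PE]] := @dsum_lift V (fun j x => if j == i then x else 0).
  by move=> j a x y; case: eqP => // _; rewrite scaler0 addr0.
exists P; split=> // [|x Fx|j x ji Fx].
- apply: (@dsum_ind [set x | F i (P x)]) => [|j x Fx].
    split=> [|a x y] /=; first by have [-> _ _] := linP lP; case: (sF i).
    rewrite lP => Fx Fy; have [_ Fl] := sF i; exact: Fl.
  by rewrite /= (PE j) //; case: eqP Fx => [->|_ _] //; case: (sF i).
- by rewrite (PE i) ?eqxx.
by rewrite (PE j) // (negPf ji).
Qed.

End DirectSums.

(** * Counit identities in quasi-Hopf algebras *)

Section Counit.
Variables (k : fieldType) (H : quasiHopf k).

(** With [V] arbitrary, the counit can be applied to any leg of a right-bracketed tensor power. *)
Definition counitl (V : lmodType k) : H ⊗ V -> V := tlift (fun a v => qeps a *: v).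
Definition counitr (V : lmodType k) : V ⊗ H -> V := tlift (fun v a => qeps a *: v).

Lemma counitl_lin V : linear (@counitl V). Proof. rewrite /counitl; lin. Qed.
Lemma counitr_lin V : linear (@counitr V). Proof. rewrite /counitr; lin. Qed.

End Counit.

Ltac lin_const f ::=
  lazymatch f with
  | @counitl _ _ _ => exact: counitl_lin
  | @counitr _ _ _ => exact: counitr_lin
  end.

Section CounitTheory.
Variables (k : fieldType) (H : quasiHopf k).

Lemma counitlE (V : lmodType k) (a : H) (v : V) : counitl (a ⊗ v) = qeps a *: v.
Proof. by rewrite /counitl tliftE //; lin. Qed.

Lemma counitrE (V : lmodType k) (a : H) (v : V) : counitr (v ⊗ a) = qeps a *: v.
Proof. by rewrite /counitr tliftE //; lin. Qed.

Lemma counitlZ (V : lmodType k) c (t : H ⊗ V) : counitl (c *: t) = c *: counitl t.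
Proof. by have [_ _ ->] := linP (@counitl_lin _ H V). Qed.

Lemma counitlM (A : algType k) (s t : H ⊗ A) :
  counitl (s * t) = counitl s * counitl t.
Proof.
move: s; apply: tens_ext; [lin|lin|] => a b.
move: t; apply: tens_ext; [lin|lin|] => c d.
by rewrite tensM !counitlE rmorphM -scalerAl -scalerAr scalerA.
Qed.

Lemma epsM (x y : H) : qeps (x * y) = qeps x * qeps y. Proof. exact: rmorphM. Qed.

Lemma epsZ c (x : H) : qeps (c *: x) = c * qeps x. Proof. exact: linearZ. Qed.

Lemma eps1 : qeps (1 : H) = 1. Proof. exact: rmorph1. Qed.

Lemma counitl1 (A : algType k) : counitl (1 : H ⊗ A) = 1.
Proof. by rewrite counitlE eps1 scale1r. Qed.

Lemma counitr1 (A : algType k) : counitr (1 : A ⊗ H) = 1.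
Proof. by rewrite counitrE eps1 scale1r. Qed.
End CounitTheory.

Section QuasiHopfFacts.
Variables (k : fieldType) (H : quasiHopf k).
Local Notation eL := (@counitl k H _).
Local Notation eR := (@counitr k H _).
Local Notation Phi := (@qPhi k H).
Local Notation PhiV := (@qPhiV k H).
Local Notation Delta := (@qDelta k H).

Let lD : linear Delta. Proof. exact: lin_can. Qed.

Let eL_D x : eL (Delta x) = x. Proof. exact: qcounitl. Qed.
Let eR_D x : eR (Delta x) = x. Proof. exact: qcounitr. Qed.

Lemma tens1 (A B : algType k) : (1 : A) ⊗ (1 : B) = 1. Proof. by []. Qed.

(* [tmap idfun eL] applies the counit to the second leg of H ⊗ (H ⊗ V) and deletes it. *)
Lemma Phi_counit_mid : tmap idfun eL Phi = 1.
Proof.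
rewrite -tens1 -qPhi_eps; move: Phi; apply: tens_ext3; [lin| |].
  by apply: tlift3_lin; lin.
move=> a b c; rewrite tmapE; [|lin..].
by rewrite counitlE tlift3E; [rewrite tensZr|lin].
Qed.

(** The counit on the second of four legs, to be applied to the pentagon. *)
Let T2 := tmap idfun eL : H ⊗ (H ⊗ (H ⊗ H)) -> H ⊗ (H ⊗ H).

Let T2lin : linear T2. Proof. by rewrite /T2; lin. Qed.

Let T2E a t : T2 (a ⊗ t) = a ⊗ eL t. Proof. by rewrite /T2 tmapE //; lin. Qed.

Let T2M x y : T2 (x * y) = T2 x * T2 y.
Proof. by apply: tmapM; [lin|lin|by []|exact: counitlM]. Qed.

Lemma counit2_D_id_id t : tmap idfun eL (D_id_id Delta t) = t.
Proof.
rewrite -/(T2 _) /D_id_id; move: t; apply: tens_ext; [lin|lin|] => a t.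
rewrite tmapE; [|lin..]; rewrite -[in RHS](eR_D a).
move: (Delta a); apply: tens_ext; [lin|lin|] => b c.
rewrite tassocE T2E counitlE counitrE.
rewrite tensZr.
by rewrite tensZl.
Qed.

Lemma counit2_id_D_id t : tmap idfun eL (id_D_id Delta t) = t.
Proof.
rewrite -/(T2 _) /id_D_id /D_id; move: t; apply: tens_ext3; [lin|lin|] => a b c.
rewrite !tmapE //; [|lin..]; rewrite -[in RHS](eL_D b) T2E; congr (_ ⊗ _).
move: (Delta b); apply: tens_ext; [lin|lin|] => d e.
rewrite tassocE !counitlE.
by rewrite tensZl.
Qed.

Lemma counit2_id_id_D t :
  tmap idfun eL (id_id_D Delta t) = id_D Delta (tmap idfun eL t).
Proof.
rewrite -/(T2 _) /id_id_D /id_D; move: t; apply: tens_ext3; [lin|lin|] => a b c.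
rewrite !tmapE //; [|lin..]; rewrite T2E !counitlE; congr (_ ⊗ _).
by have [_ _ ->] := linP lD.
Qed.

Lemma counit2_tensr1 (t : H ⊗ (H ⊗ H)) :
  tmap idfun eL (tensr1 t) = tmap idfun (fun c => c ⊗ 1) (tmap idfun eL t).
Proof.
rewrite -/(T2 _) /tensr1; move: t; apply: tens_ext3; [lin|lin|] => a b c.
rewrite !tmapE //; [|lin..]; rewrite T2E !counitlE; congr (_ ⊗ _).
by rewrite tensZl.
Qed.

Let D1 : Delta 1 = 1. Proof. exact: rmorph1. Qed.

Lemma counit2_tensr1_Phi : tmap idfun eL (tensr1 Phi) = 1.
Proof. by rewrite counit2_tensr1 Phi_counit_mid tmapE //; lin. Qed.

(** The counit on the second leg of the pentagon leaves [(1 ⊗ eL Phi) * Phi = Phi]; cancel [Phi] and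
    apply the counit once more. *)
Lemma Phi_counitl : eL Phi = 1.
Proof.
have := congr1 T2 (qpentagon H); rewrite !T2M T2E /T2.
rewrite counit2_D_id_id counit2_id_D_id counit2_id_id_D counit2_tensr1_Phi.
rewrite Phi_counit_mid id_D_1 // mulr1 mul1r => /(congr1 ( *%R^~ PhiV)).
rewrite -mulrA qPhiK mulr1 => /(congr1 eL).
by rewrite counitlE eps1 scale1r counitl1.
Qed.

Let T3 := tmap idfun (tmap idfun eL) : H ⊗ (H ⊗ (H ⊗ H)) -> H ⊗ (H ⊗ H).

Let T3lin : linear T3. Proof. by rewrite /T3; lin. Qed.

Let T3M x y : T3 (x * y) = T3 x * T3 y.
Proof.
apply: tmapM => [|||s t]; [lin|lin|by []|].
by apply: tmapM; [lin|lin|by []|exact: counitlM].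
Qed.

(** The counit on the third leg reduces the pentagon to [Phi] times a copy of [tmap idfun eR Phi]
    padded by a unit, equal to [Phi]. *)
Lemma Phi_counitr : tmap idfun eR Phi = 1.
Proof.
have T3E a b t : T3 (a ⊗ (b ⊗ t)) = a ⊗ (b ⊗ eL t).
  by rewrite /T3 !tmapE //; lin.
have e1 : T3 (1 ⊗ Phi) = 1 by rewrite /T3 tmapE ?Phi_counit_mid //; lin.
have e2 t : T3 (id_D_id Delta t) = t.
  rewrite /id_D_id /D_id; move: t; apply: tens_ext3; [lin|lin|] => a b c.
  rewrite !tmapE //; [|lin..]; rewrite -[in RHS](eR_D b).
  move: (Delta b); apply: tens_ext; [lin|lin|] => d e.
  rewrite tassocE T3E counitlE counitrE; congr (_ ⊗ _).
  rewrite tensZl.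
  by rewrite tensZr.
have e3 t : T3 (tensr1 t) = tmap idfun (fun b => b ⊗ 1) (tmap idfun eR t).
  rewrite /tensr1; move: t; apply: tens_ext3; [lin|lin|] => a b c.
  rewrite !tmapE //; [|lin..]; rewrite T3E counitlE counitrE; congr (_ ⊗ _).
  rewrite tensZl.
  by rewrite tensZr.
have e4 t : T3 (id_id_D Delta t) = t.
  rewrite /id_id_D /id_D; move: t; apply: tens_ext3; [lin|lin|] => a b c.
  by rewrite !tmapE //; [rewrite T3E eL_D|lin..].
have e5 t : T3 (D_id_id Delta t) = D_id Delta (tmap idfun eL t).
  rewrite /D_id_id /D_id; move: t; apply: tens_ext; [lin|lin|] => a t.
  rewrite !tmapE //; [|lin..].
  move: (Delta a); apply: tens_ext; [lin|lin|] => b c.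
  by rewrite !tassocE T3E.
have e6 (t : H ⊗ H) : tmap idfun eR (tmap idfun (fun b : H => b ⊗ (1 : H)) t) = t.
  move: t; apply: tens_ext; [lin|lin|] => a b.
  by rewrite !tmapE //=; [rewrite counitrE eps1 scale1r|lin..].
have := congr1 T3 (qpentagon H); rewrite !T3M.
rewrite e1 e2 e3 e4 e5 Phi_counit_mid D_id_1 // mul1r mulr1.
move=> /(congr1 ( *%R PhiV)); rewrite mulrA qPhiVK mul1r.
move=> /(congr1 (tmap idfun eR)); rewrite e6 => ->.
by apply: tmap1; [lin|lin|by []|exact: counitr1].
Qed.

Lemma PhiV_counit_mid : tmap idfun eL PhiV = 1.
Proof.
have := congr1 (tmap idfun eL) (@qPhiK _ H).
rewrite tmapM; [|lin|lin|by []|exact: counitlM].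
rewrite Phi_counit_mid mul1r => ->.
by apply: tmap1; [lin|lin|by []|exact: counitl1].
Qed.

(** Apply the counit to [S(x') alpha x'' = eps(x) alpha] and use [eps(alpha) = 1]. *)
Lemma eps_S (x : H) : qeps (qS x) = qeps x.
Proof.
pose e := qeps : H -> k^o.
have le : linear e by exact: eps_lin.
have E (t : (H ⊗ H)%type) :
    e (tlift (fun a b => qS a * qalpha * b) t) = e (qS (eR t)).
  move: t; apply: tens_ext; [lin|lin|] => a b.
  rewrite counitrE tliftE /e; last lin.
  have [_ _ ->] := linP (lin_can (@qS k H)); by rewrite epsZ !epsM qeps_alpha mulr1 mulrC.

have := congr1 qeps (qantipl x).
by rewrite [LHS]E eR_D epsZ qeps_alpha mulr1.
Qed.

End QuasiHopfFacts.

(** * Homogeneous inverses and the Drinfeld twist *)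

Section AlgebraGradings.
Variables (k : fieldType) (G : groupType) (H : algType k) (F : G -> set H).
Hypothesis dF : direct_sum F.
Hypothesis FM : forall g h x y, F g x -> F h y -> F (g * h)%g (x * y).

(** The neutral component [P 1] is a left unit: for homogeneous [x], it alone contributes to the
    component of [1 * x] in the degree of [x]. Hence it equals 1. *)
Lemma graded_one : F 1%g 1.
Proof.
have [P [lP FP PE P0]] := dsum_proj dF 1%g.
have P1l : forall x, P 1 * x = x.
  apply: (dsum_ext dF) => [||g x Fx]; [lin|lin|].
  have [Q [lQ FQ QE Q0]] := dsum_proj dF g.
  rewrite -[in RHS](QE x) // -{2}[x]mul1r.
  (* The claim is generalized to [P y * x = Q (y * x)], linear in [y], so that [y] may be taken
     homogeneous. *)
  move: (1 : H); apply: (dsum_ext dF) => [||h y Fy]; [lin|lin|].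
  case: (eqVneq h 1%g) Fy => [->|h1] Fy.
    by rewrite PE // QE // -{1}[g]mul1g; apply: FM.
  rewrite (P0 _ _ h1) // mul0r (Q0 (h * g)%g) //; last exact: FM.
  by apply: contra h1 => /eqP e; apply/eqP/(mulIg g); rewrite mul1g.
by rewrite -[1]P1l mulr1.
Qed.

(* The projection P onto the neutral component is linear over it, so applying
   P ⊗ P ⊗ P to t * tV = 1 exhibits (P ⊗ P ⊗ P) tV as another inverse of t. *)
Lemma graded_inverse3 (t tV : H ⊗ (H ⊗ H)) :
  t * tV = 1 -> tV * t = 1 ->
  tsub (F 1%g) (tsub (F 1%g) (F 1%g)) t -> tsub (F 1%g) (tsub (F 1%g) (F 1%g)) tV.
Proof.
move=> tK tVK t1; have [P [lP FP PE P0]] := dsum_proj dF 1%g.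
have sF : subspace (F 1%g) by case: dF.
have PM x y : F 1%g x -> P (x * y) = x * P y.
  move=> Fx; move: y; apply: (dsum_ext dF) => [||h y Fy]; [lin|lin|].
  have [h1|h1] := eqVneq h 1%g; last first.
    by rewrite !(P0 _ _ h1) ?mulr0 // -[h]mul1g; apply: FM.
  by rewrite h1 in Fy; rewrite !PE // -[1%g]mul1g; apply: FM.
pose PPP := tmap P (tmap P P).
have lPPP : linear PPP by rewrite /PPP; lin.
have sub3 s : tsub (F 1%g) (tsub (F 1%g) (F 1%g)) (PPP s).
  have s2 := tsub_subspace (F 1%g) sF.
  have s3 := tsub_subspace (tsub (F 1%g) (F 1%g)) sF.
  move: s; apply: (tens_map s3) => // a s; rewrite /PPP tmapE; [|lin..].
  apply: tsub_tens => //; move: s; apply: (tens_map s2) => [|b c]; first lin.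
  by rewrite tmapE //; apply: tsub_tens.
have PPPM u s : tsub (F 1%g) (tsub (F 1%g) (F 1%g)) u -> PPP (u * s) = u * PPP s.
  move=> u1; move: s; apply: tens_ext3; [lin|lin|] => a b c; move: u u1.
  apply: tsub_ext3; [lin|lin|] => a' b' c' Fa Fb Fc.
  by rewrite /PPP !tensM !tmapE ?tensM ?PM //; lin.
have PPP1 : PPP 1 = 1.
  have P1 : P 1 = 1 by rewrite PE //; exact: graded_one.
  by apply: tmap1 => //; [lin|exact: tmap1].
have : t * PPP tV = 1 by rewrite -PPPM // tK.
by move=> /(congr1 ( *%R tV)); rewrite mulrA tVK mul1r mulr1 => <-.
Qed.

End AlgebraGradings.

Section Twist.
Variables (k : fieldType) (H : quasiHopf k) (B : set H).
Hypotheses (sB : subspace B) (B1 : B 1).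
Hypothesis BM : forall x y, B x -> B y -> B (x * y).
Hypothesis BD : forall x, B x -> tsub B B (qDelta x).
Hypothesis Bphi : tsub B (tsub B B) (@qPhi k H).
Hypothesis BphiV : tsub B (tsub B B) (@qPhiV k H).

Let s2 : subspace (tsub B B). Proof. exact: tsub_subspace. Qed.
Let s3 : subspace (tsub B (tsub B B)). Proof. exact: tsub_subspace. Qed.
Let s4 : subspace (tsub B (tsub B (tsub B B))). Proof. exact: tsub_subspace. Qed.

Let B2M s t : tsub B B s -> tsub B B t -> tsub B B (s * t).
Proof. exact: tensM_sub. Qed.

(** [drinfeld_A] is built from [Phi], [PhiV] and Delta; it is kept apart from the twist in order to
    apply to the neutral weight space before stability of weights under [S] is known. *)
Lemma drinfeld_A_sub : tsub B (tsub B (tsub B B)) (drinfeld_A H).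
Proof.
apply: (tensM_sub (X := B) (X' := B) (Y := tsub B (tsub B B))
  (Y' := tsub B (tsub B B))) => //; first by do 2!apply: tensM_sub => //.
- move: (qPhi) Bphi; rewrite /tensr1; apply: (tsub_map s4) => [|a t Ba Bt]; first lin.
  rewrite tmapE; [|lin..]; apply: tsub_tens => //.
  move: t Bt; apply: (tsub_map s3) => [|b c Bb Bc]; first lin.
  rewrite tmapE; [|lin..]; apply: tsub_tens => //.
  exact: tsub_tens.
move: (qPhiV) BphiV; rewrite /D_id_id; apply: (tsub_map s4) => [|a t Ba Bt]; first lin.
rewrite tmapE; [|lin..].
move: (qDelta a) (BD Ba); apply: (tsub_map s4) => [|b c Bb Bc]; first lin.
by rewrite tassocE; apply: tsub_tens => //; exact: tsub_tens.
Qed.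

Hypotheses (BS : forall x, B x -> B (qS x)) (Ba : B qalpha) (Bb : B qbeta).

Lemma drinfeld_twist_sub : tsub B B (drinfeld_twist H).
Proof.
have gamma_sub : tsub B B (drinfeld_gamma0 H).
  rewrite /drinfeld_gamma0 /tlift4.
  move: (drinfeld_A H) drinfeld_A_sub.
  apply: (tsub_map s2) => [|a1 t Ba1 Bt]; first by rewrite /tlift3; lin.
  rewrite tliftE; last by rewrite /tlift3; lin.
  move: t Bt; apply: (tsub_map s2) => [|a2 t Ba2 Bt]; first lin.
  rewrite /tlift3 tliftE; last lin.
  move: t Bt; apply: (tsub_map s2) => [|a3 a4 Ba3 Ba4]; first lin.
  by rewrite tliftE; [apply: tsub_tens; do 2?apply: BM => //; exact: BS|lin].
rewrite /drinfeld_twist; move: (qPhiV) BphiV.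
rewrite /tlift3; apply: (tsub_map s2) => [|a t Ha Ht]; first lin.
rewrite tliftE; last lin.
move: t Ht; apply: (tsub_map s2) => [|b c Hb Hc]; first lin.
rewrite tliftE; last lin.
apply: B2M; [apply: B2M|] => //; last first.
  by apply: BD; do 2?apply: BM => //; exact: BS.
move: (qDelta a) (BD Ha); apply: (tsub_map s2) => [|x y Hx Hy]; first lin.
rewrite tswapE tmapE; [|lin..].
by apply: tsub_tens; exact: BS.
Qed.

End Twist.

(** * Weight spaces *)

Section GroupAlgebraCoefficients.
Variables (k : fieldType) (G : groupType).
Local Notation kG := (group_quasiHopf k G).

Definition zcoef (g : G) : kG -> k^o :=
  zext (fun h => if h == g then 1 else 0 : k^o).

Lemma zcoef_lin g : linear (zcoef g). Proof. exact: zext_lin. Qed.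

Lemma zcoefE g h : zcoef g (zeta k h) = if h == g then 1 else 0.
Proof. exact: zextE. Qed.

Definition lcoef (V : lmodType k) (g : G) : kG ⊗ V -> V :=
  tlift (fun z v => zcoef g z *: v).

Lemma lcoef_bilin (V : lmodType k) g : bilin (fun z (v : V) => zcoef g z *: v).
Proof. have := zcoef_lin g; lin. Qed.

Lemma lcoef_lin V g : linear (@lcoef V g).
Proof. exact/tlift_lin/lcoef_bilin. Qed.

Lemma lcoefE (V : lmodType k) g h (v : V) :
  lcoef g (zeta k h ⊗ v) = if h == g then v else 0.
Proof.
rewrite /lcoef tliftE ?zcoefE; last exact: lcoef_bilin.
by case: eqP => _; rewrite ?scale1r ?scale0r.
Qed.

Lemma zeta_span (C : set kG) :
  subspace C -> (forall g, C (zeta k g)) -> forall z, C z.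
Proof.
move=> sC Cz z.
have -> : z = zext (@zeta k G) z.
  by move: z; apply: zeta_ext => // [|g]; [exact: zext_lin|rewrite zextE].
by apply: subspace_sum => // g _; apply: subspaceZ.
Qed.

Lemma ztens_ext (V U : lmodType k) (f h : kG ⊗ V -> U) :
  linear f -> linear h -> (forall g v, f (zeta k g ⊗ v) = h (zeta k g ⊗ v)) ->
  forall t, f t = h t.
Proof.
move=> lf lh fh; apply: tens_ext => // z v; move: z.
by apply: zeta_ext; [lin|lin|].
Qed.

Lemma ztens_span (V U : lmodType k) (C : set U) (f : kG ⊗ V -> U) :
  subspace C -> linear f -> (forall g v, C (f (zeta k g ⊗ v))) -> forall t, C (f t).
Proof.
move=> sC lf Cf; apply: tens_map => // z v; move: z.
apply: (@zeta_span [set z | C (f (z ⊗ v))]) => //=.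
have lfv : linear (fun z : kG => f (z ⊗ v)) by lin.
split=> [|a x y] /=; first by have [-> _ _] := linP lfv; case: sC.
by rewrite lfv => Cx Cy; case: sC => _; apply.
Qed.

End GroupAlgebraCoefficients.

Section WeightSpaces.
Variables (k : fieldType) (G : groupType) (H : quasiHopf k).
Local Notation kG := (group_quasiHopf k G).
Variable pi : H -> kG.
Hypothesis lpi : linear pi.

Definition coaction (x : H) : kG ⊗ H := tmap pi idfun (qDelta x).

Lemma coaction_lin : linear coaction. Proof. rewrite /coaction; lin. Qed.

Lemma coactionE g x : weight_space pi g x -> coaction x = zeta k g ⊗ x.
Proof. by []. Qed.

(** The coefficient of [zeta k g] in the coaction. It selects the weight [g] part of a sum of weight
    vectors; that its values have weight [g] is shown later from coassociativity. *)
Definition wproj (g : G) (x : H) : H := lcoef g (coaction x).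

Lemma wproj_lin g : linear (wproj g).
Proof. exact/lin_comp/coaction_lin/lcoef_lin. Qed.

Lemma wprojE g h x : weight_space pi h x -> wproj g x = if h == g then x else 0.
Proof. by move=> /coactionE wx; rewrite /wproj wx lcoefE. Qed.

Lemma weight_subspace g : subspace (weight_space pi g).
Proof.
have lr := coaction_lin; split=> [|a x y].
  change (coaction 0 = zeta k g ⊗ 0); have [-> _ _] := linP lr.
  by have [-> _ _] := linP (@tens_linr _ kG H (zeta k g)).
move=> /coactionE wx /coactionE wy.
change (coaction (a *: x + y) = zeta k g ⊗ (a *: x + y)).
by rewrite lr wx wy tens_linr.
Qed.

Lemma weight_indep (s : seq G) (c : G -> H) :
  uniq s -> (forall g, weight_space pi g (c g)) -> \sum_(g <- s) c g = 0 ->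
  forall g, g \in s -> c g = 0.
Proof.
move=> us cW c0 g gs; have := congr1 (wproj g) c0.
have lw := wproj_lin g; rewrite lin_sum //; have [-> _ _] := linP lw.
rewrite (bigD1_seq g) //= (wprojE _ (cW g)) eqxx big1 ?addr0 // => h hg.
by rewrite (wprojE _ (cW h)) (negPf hg).
Qed.

(** [wproj pi g] maps every [F h] into [F g], hence all of [H] into [F g]; but it is the identity on
    weight [g]. *)
Lemma weight_space_unique (F : G -> set H) :
  direct_sum F -> (forall g x, F g x -> weight_space pi g x) ->
  weight_space pi = F.
Proof.
move=> dF FW; apply/funext => g; apply/seteqP; split=> [x Wx|x /FW //].
have [sF _ _] := dF; have lw := wproj_lin g.
have <- : wproj g x = x by rewrite (wprojE _ Wx) eqxx.
apply: (dsum_ind dF (C := [set y | F g (wproj g y)])) => [|h y Fy] /=.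
  split=> [|a y z] /=; first by have [-> _ _] := linP lw; case: (sF g).
  by rewrite lw => Fy Fz; case: (sF g) => _; apply.
rewrite (wprojE _ (FW _ _ Fy)).
by case: (eqVneq h g) Fy => [->|_ _] //; case: (sF g).
Qed.

End WeightSpaces.

Ltac lin_const f ::=
  lazymatch f with
  | @counitl _ _ _ => exact: counitl_lin
  | @counitr _ _ _ => exact: counitr_lin
  | @lcoef _ _ _ _ => exact: lcoef_lin
  | @zcoef _ _ _ => exact: zcoef_lin
  | coaction _ => apply: coaction_lin; lin
  | wproj _ _ => apply: wproj_lin; lin
  end.

(** * From gradings to morphisms *)

Section GroupAlgebraStructure.
Variables (k : fieldType) (G : groupType).
Local Notation kG := (group_quasiHopf k G).

Lemma zeta_Delta g : qDelta (zeta k g : kG) = zeta k g ⊗ zeta k g.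
Proof. exact: zextE. Qed.

Lemma zeta_S g : qS (zeta k g : kG) = zeta k g^-1%g.
Proof. exact: zextE. Qed.

Lemma zeta_eps g : qeps (zeta k g : kG) = 1.
Proof. exact: (@zextE k G k^o). Qed.

Lemma zeta_mul g h : (zeta k g : kG) * (zeta k h : kG) = zeta k (g * h)%g.
Proof. exact: zetaM. Qed.

Lemma zeta1 : (zeta k 1%g : kG) = 1. Proof. by []. Qed.

End GroupAlgebraStructure.

Section GroupLikeMaps.
Variables (k : fieldType) (G : groupType) (H : quasiHopf k).
Local Notation kG := (group_quasiHopf k G).
Variables (pi : H -> kG) (B : set H) (g : G).
Hypotheses (lpi : linear pi) (piB : forall x, B x -> pi x = qeps x *: zeta k g).

(** On [B] the map [pi] is the counit times [zeta k g], so it deletes that leg and inserts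
    [zeta k g]. *)
Lemma tmap_groupl (V : lmodType k) (t : H ⊗ V) :
  tsub B setT t -> tmap pi idfun t = zeta k g ⊗ counitl t.
Proof.
move: t; apply: tsub_ext; [lin|lin|] => a v Ba _.
by rewrite tmapE //; rewrite (piB Ba) counitlE tensZl tensZr.
Qed.

Lemma tmap_groupr (V : lmodType k) (t : V ⊗ H) :
  tsub setT B t -> tmap idfun pi t = counitr t ⊗ zeta k g.
Proof.
move: t; apply: tsub_ext; [lin|lin|] => v a _ Ba.
by rewrite tmapE //; rewrite (piB Ba) counitrE tensZl tensZr.
Qed.

End GroupLikeMaps.

Section GradingToMorphism.
Variables (k : fieldType) (G : groupType) (H : quasiHopf k) (F : G -> set H).
Local Notation kG := (group_quasiHopf k G).
Hypothesis gF : is_grading F.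

Let dF : direct_sum F := gr_sum gF.
Let sF g : subspace (F g). Proof. by case: dF. Qed.

Lemma grading_ex_morphism : exists pi : H -> kG,
  linear pi /\ forall g x, F g x -> pi x = qeps x *: zeta k g.
Proof. by apply: (dsum_lift dF (phi := fun g x => qeps x *: (zeta k g : kG))) => g; lin. Qed.

Variable pi : H -> kG.
Hypotheses (lpi : linear pi) (piE : forall g x, F g x -> pi x = qeps x *: zeta k g).

Let F1 : F 1%g 1 := graded_one dF (gr_mul gF).

Let tmap_pil g := tmap_groupl lpi (@piE g).
Let tmap_pir g := tmap_groupr lpi (@piE g).

(** The first leg of [Delta x] lies in [F g], so [pi] turns it into [zeta k g], and the counit axiom
    leaves [x]. *)
Lemma grading_weight g x : F g x -> weight_space pi g x.
Proof.
move=> Fx; have Dx := gr_Delta gF Fx.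
by rewrite /weight_space /= (tmap_pil (tsubT_l Dx)) [counitl _]qcounitl.
Qed.

Lemma grading_weight_space : weight_space pi = F.
Proof. exact: weight_space_unique dF grading_weight. Qed.

Lemma grading_qh_morphism : qh_morphism pi.
Proof.
have lD : linear (@qDelta k kG) := lin_can _.
have lS : linear (@qS k kG) := lin_can _.
split=> //.
- split=> [|x y]; first by rewrite (piE F1) eps1 scale1r.
  move: x; apply: (dsum_ext dF) => [||g x Fx]; [lin|lin|].
  move: y; apply: (dsum_ext dF) => [||h y Fy]; [lin|lin|].
  rewrite (piE (gr_mul gF Fx Fy)) (piE Fx) (piE Fy) epsM.
  by rewrite -scalerAl -scalerAr scalerA zeta_mul.
- apply: (dsum_ext dF) => [||g x Fx]; [lin|lin|].
  have Dx := gr_Delta gF Fx; rewrite (piE Fx); have [_ _ ->] := linP lD.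
  rewrite zeta_Delta.
  (* One leg at a time: the first yields [zeta k g], and the counit axiom leaves [pi x] in the
     second. *)
  have -> : tmap pi pi (qDelta x) = tmap idfun pi (tmap pi idfun (qDelta x)).
    by rewrite tmap_comp //.
  rewrite (tmap_pil (tsubT_l Dx)) [counitl _]qcounitl tmapE //.
  by rewrite (piE Fx) tensZr.
- move=> x; apply: (dsum_ext dF (f := (fun x => qeps (pi x)) : H -> k^o)
    (g := qeps : H -> k^o)) => [||g y Fy].
  + by apply: (lin_comp (@eps_lin _ kG) lpi).
  + exact: eps_lin.
  by rewrite (piE Fy) epsZ zeta_eps mulr1.
- apply: (dsum_ext dF) => [||g x Fx]; [lin|lin|].
  rewrite (piE Fx) (piE (gr_S gF Fx)) eps_S.
  by have [_ _ ->] := linP lS; rewrite zeta_S.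
(* All legs of [Phi] lie in [F 1], so only the total counit of [Phi] survives as a scalar; it is 1
   by [Phi_counitl]. *)
- have -> : tmap pi (tmap pi pi) qPhi = qeps (counitl (counitl (@qPhi k H)))
      *: ((zeta k 1%g : kG) ⊗ ((zeta k 1%g : kG) ⊗ (zeta k 1%g : kG))).
    move: (qPhi) (gr_Phi gF); apply: tsub_ext3; [lin|lin|] => a b c Fa Fb Fc.
    rewrite !tmapE //; [|lin..]; rewrite (piE Fa) (piE Fb) (piE Fc).
    by rewrite counitlE counitlZ counitlE !epsZ -!scalerA tensZl tensZl !tensZr.
  by rewrite Phi_counitl counitl1 eps1 scale1r.
- by rewrite (piE (gr_alpha gF)) qeps_alpha scale1r.
- by rewrite (piE (gr_beta gF)) qeps_beta scale1r.
Qed.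

Lemma grading_twist : tsub (F 1%g) (F 1%g) (drinfeld_twist H).
Proof.
have FM x y : F 1%g x -> F 1%g y -> F 1%g (x * y).
  by rewrite -{3}[1%g]mulg1; apply: (gr_mul gF).
apply: drinfeld_twist_sub => //; try by case: gF.
- exact: (gr_Delta gF).
- by apply: (graded_inverse3 dF (gr_mul gF) (@qPhiK _ H)); [exact: qPhiVK|exact: (gr_Phi gF)].
by move=> x /(gr_S gF); rewrite invg1.
Qed.

Hypothesis fF : faithful F.

Lemma grading_to_morphism : is_grading_morphism pi.
Proof.
split; rewrite ?grading_weight_space.
- exact: grading_qh_morphism.
(* On [F g] both sides equal [x ⊗ zeta k g], by the two counit axioms. *)
- have lc : linear (fun x => tmap idfun pi (tswap (qDelta x))) by lin.
  apply: (dsum_ext dF) => // [|g x Fx]; first lin.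
  have Dx := gr_Delta gF Fx.
  have Dx' : tsub (F g) (F g) (tswap (qDelta x)).
    move: (qDelta x) Dx; apply: tsub_map => [||a b Fa Fb].
    - exact: tsub_subspace.
    - lin.
    by rewrite tswapE; apply: tsub_tens.
  rewrite (tmap_pir (tsubT_r Dx)) (tmap_pir (tsubT_r Dx')) [counitr (qDelta _)]qcounitr.
  have -> (t : H ⊗ H) : counitr (tswap t) = counitl t.
    move: t; apply: tens_ext; [lin|lin|] => a b.
    by rewrite tswapE counitrE counitlE.
  by rewrite [counitl _]qcounitl.
- have sI : subspace [set z : kG | exists x, pi x = z].
    split=> [|a _ _ [x <-] [y <-]]; first by exists 0; case: (linP lpi).
    by exists (a *: x + y); rewrite lpi.
  apply: (zeta_span sI) => g; have [x Fx x0] := fF g.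
  (* If the counit vanished on [F g], then [x = (eps ⊗ id)(Delta x)] would be 0, since [Delta x] has
     its left legs in [F g]. *)
  have [y Fy ey] : exists2 y, F g y & qeps y != 0.
    apply: contrapT => nE; case/eqP: x0; rewrite -(qcounitl x).
    rewrite -[LHS]/(counitl _).
    move: (qDelta x) (gr_Delta gF Fx).
    apply: tsub_ext; [lin|by move=> a u v; rewrite scaler0 addr0|] => a b Fa _.
    rewrite counitlE; case: (eqVneq (qeps a) 0) => [->|ea]; first exact: scale0r.
    by case: nE; exists a.
  exists ((qeps y)^-1 *: y); have [_ _ ->] := linP lpi.
  by rewrite (piE Fy) scalerA mulVf // scale1r.
- exact: (gr_Phi gF).
- exact: (gr_alpha gF).
- exact: (gr_beta gF).
exact: grading_twist.
Qed.

End GradingToMorphism.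

(** * From morphisms to gradings *)

Section MorphismToGrading.
Variables (k : fieldType) (G : groupType) (H : quasiHopf k).
Local Notation kG := (group_quasiHopf k G).
Variable pi : H -> kG.
Hypothesis gm : is_grading_morphism pi.

Local Notation W := (weight_space pi).
Local Notation rho := (coaction pi).
Local Notation Delta := (@qDelta k H).
Local Notation Phi := (@qPhi k H).
Local Notation PhiV := (@qPhiV k H).
Local Notation S := (@qS k H).

Let lpi : linear pi := qhm_linear (gm_morphism gm).
Let piM x y : pi (x * y) = pi x * pi y.
Proof. by case: (qhm_mult (gm_morphism gm)). Qed.
Let pi1 : pi 1 = 1. Proof. by case: (qhm_mult (gm_morphism gm)). Qed.

Let lrho : linear rho := coaction_lin lpi.
Let lD : linear Delta := lin_can _.
Let lDk : linear (@qDelta k kG) := lin_can _.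
Let lS : linear S := lin_can _.
Let sW g : subspace (W g) := weight_subspace lpi g.

(** * The coaction and the weight decomposition *)

Lemma counitl_coaction x : counitl (rho x) = x.
Proof.
rewrite -[RHS]qcounitl -[tlift _ _]/(counitl _) /coaction.
move: (Delta x); apply: tens_ext; [lin|lin|] => a b.
by rewrite tmapE // !counitlE (qhm_eps (gm_morphism gm)).
Qed.

Lemma counitr_coaction x : counitr (rho x) = pi x.
Proof.
rewrite -[x in RHS]qcounitr -[tlift _ _]/(counitr _) /coaction.
move: (Delta x); apply: tens_ext; [lin|lin|] => a b.
by rewrite tmapE // !counitrE; have [_ _ ->] := linP lpi.
Qed.

(** Apply [id ⊗ eps] to [rho x = zeta k g ⊗ x]. This formula recovers [pi] from its weight
    spaces. *)
Lemma weight_pi g x : W g x -> pi x = qeps x *: zeta k g.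
Proof. by move=> /coactionE wx; rewrite -counitr_coaction wx counitrE. Qed.

Lemma coactionM x y : rho (x * y) = rho x * rho y.
Proof. by rewrite /coaction rmorphM tmapM. Qed.

Lemma weight1 : W 1%g 1.
Proof. by rewrite /weight_space /= rmorph1; exact: tmap1. Qed.

Lemma weightM g h x y : W g x -> W h y -> W (g * h)%g (x * y).
Proof.
move=> /coactionE wx /coactionE wy.
by change (rho (x * y) = zeta k (g * h)%g ⊗ (x * y));
  rewrite coactionM wx wy tensM zeta_mul.
Qed.

Let tmap_pil := tmap_groupl lpi (@weight_pi 1%g).
Let tmap_pir := tmap_groupr lpi (@weight_pi 1%g).

Lemma coaction_coassoc x :
  tmap idfun rho (rho x) = tassoc (tmap qDelta idfun (rho x)).
Proof.
pose M := tmap pi (tmap pi idfun) : H ⊗ (H ⊗ H) -> kG ⊗ (kG ⊗ H).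
have lM : linear M by rewrite /M; lin.
have MM s t : M (s * t) = M s * M t.
  by apply: tmapM => [|||a b] //; [lin|apply: tmapM].
(* The first leg of [Phi] has neutral weight, so [pi] on it gives [1 ⊗ (eps ⊗ id)(Phi) = 1]; the
   other [pi] preserves units. *)
have MPhi : M Phi = 1.
  have -> : M Phi = tmap idfun (tmap pi idfun) (tmap pi idfun Phi).
    by rewrite tmap_comp //; lin.
  rewrite (tmap_pil (tsubT_l (gm_Phi gm))) Phi_counitl tmapE //; last lin.
  by congr (_ ⊗ _); apply: tmap1.
have := congr1 M (qcoassoc x); rewrite !MM MPhi mul1r mulr1.
have -> t : M (id_D Delta t) = tmap idfun rho (tmap pi idfun t).
  rewrite /M /id_D; move: t; apply: tens_ext; [lin|lin|] => a b.
  by rewrite !tmapE //; lin.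
move=> <-; rewrite /coaction /D_id; move: (Delta x).
apply: tens_ext; [lin|lin|] => a b.
rewrite !tmapE //; rewrite (qhm_Delta (gm_morphism gm)).
move: (Delta a); apply: tens_ext; [lin|lin|] => u v.
by rewrite /M tassocE !tmapE ?tassocE //; lin.
Qed.

(** By coassociativity [rho] of the coefficient is a coefficient of [(Delta ⊗ id)(rho x)], and each
    [zeta k h] is group-like, so only the terms with [h = g] survive. *)
Lemma wproj_weight g x : W g (wproj pi g x).
Proof.
change (rho (lcoef g (rho x)) = zeta k g ⊗ lcoef g (rho x)).
have -> (t : kG ⊗ H) : rho (lcoef g t) = lcoef g (tmap idfun rho t).
  move: t; apply: ztens_ext; [lin|lin|] => h v.
  by rewrite tmapE // !lcoefE; case: eqP => // _; case: (linP lrho).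
rewrite coaction_coassoc; move: (rho x).
apply: ztens_ext; [lin|lin|] => h v.
rewrite tmapE // [qDelta _]zeta_Delta tassocE !lcoefE.
by case: eqP => [->//|_]; case: (linP (@tens_linr _ kG H (zeta k g))).
Qed.

(** The counit of [k[G]] is the sum of the coordinate functionals, and [t] involves finitely many
    basis elements. *)
Lemma counitl_lcoef (t : kG ⊗ H) :
  exists s : seq G, counitl t = \sum_(g <- s) lcoef g t.
Proof.
(* Requiring equality over every larger duplicate-free list makes the set closed under sums of
   elements with different supports. *)
pose C := [set t : kG ⊗ H | exists2 s : seq G, uniq s & forall s', uniq s' ->
  {subset s <= s'} -> \sum_(g <- s') lcoef g t = counitl t].
suff : C t by move=> [s us /(_ s us (fun=> id)) <-]; exists s.
move: t; apply: (ztens_span (C := C) (f := id)) => [||h v].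
- split=> [|a x y [s us sx] [t ut ty]].
    exists [::] => // s' _ _; rewrite big1 => [|g _]; last by case: (linP (@lcoef_lin k G H g)).
    by case: (linP (@counitl_lin k kG H)).
  exists (undup (s ++ t)); first exact: undup_uniq.
  move=> s' us' ss'; rewrite counitl_lin -(sx s') // -?(ty s') //.
  - by rewrite scaler_sumr -big_split; apply: eq_bigr => g _; rewrite lcoef_lin.
  - by move=> g gt; apply: ss'; rewrite mem_undup mem_cat gt orbT.
  by move=> g gs; apply: ss'; rewrite mem_undup mem_cat gs.
- exact: lin_id.
exists [:: h] => // s' us' /(_ h); rewrite inE eqxx => /(_ isT) hs.
rewrite counitlE zeta_eps scale1r (bigD1_seq h) //= lcoefE eqxx big1 ?addr0 //.
by move=> g gh; rewrite lcoefE eq_sym (negPf gh).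
Qed.

Lemma weight_direct_sum : direct_sum W.
Proof.
split=> [//|x|s c]; last exact: weight_indep.
have [s sx] := counitl_lcoef (rho x).
exists s, (fun g => wproj pi g x); split=> [g|]; first exact: wproj_weight.
by rewrite -[RHS]sx counitl_coaction.
Qed.

(** For a preimage [x] of [zeta k g], the counit of [wproj pi g x] is the coefficient of [zeta k g]
    in [pi x], namely 1. *)
Lemma weight_nonzero g : exists2 x, W g x & x != 0.
Proof.
have [x px] := gm_surj gm (zeta k g).
exists (wproj pi g x); first exact: wproj_weight.
apply/eqP => w0; have : qeps (wproj pi g x) = 1.
  have -> : 1 = zcoef g (pi x) by rewrite px zcoefE eqxx.
  rewrite -counitr_coaction.
  rewrite /wproj; have lz := @zcoef_lin k G g; have le := @eps_lin k H.
  move: (rho x); apply: (@ztens_ext _ _ _ k^o).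
  - exact: (lin_comp le (@lcoef_lin k G H g)).
  - exact: (lin_comp lz (@counitr_lin k H kG)).
  move=> h v; rewrite lcoefE counitrE; have [_ _ ->] := linP lz; rewrite zcoefE.
  case: eqP => _; first by rewrite [RHS]mulr1.
  by rewrite scaler0; case: (linP le).
rewrite w0 => /esym /eqP; have [-> _ _] := linP (@eps_lin k H).
by rewrite oner_eq0.
Qed.

(** * Comultiplication on weight spaces *)

Lemma pi_cocentral x : tmap idfun pi (Delta x) = tswap (rho x).
Proof.
rewrite (gm_cocentral gm) /coaction; move: (Delta x).
by apply: tens_ext; [lin|lin|] => a b; rewrite tswapE !tmapE // tswapE.
Qed.

(** Quasi-coassociativity under [pi ⊗ id ⊗ id], which sends [Phi] to 1. *)
Lemma coaction_Delta_l x :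
  tassoc (tmap rho idfun (Delta x)) = tmap idfun Delta (rho x).
Proof.
pose N := tmap pi idfun : H ⊗ (H ⊗ H) -> kG ⊗ (H ⊗ H).
have lN : linear N by rewrite /N; lin.
have NM s t : N (s * t) = N s * N t by exact: tmapM.
have NPhi : N Phi = 1.
  by rewrite /N (tmap_pil (tsubT_l (gm_Phi gm))) Phi_counitl.
have := congr1 N (qcoassoc x); rewrite !NM NPhi mul1r mulr1.
have -> t : N (id_D Delta t) = tmap idfun Delta (tmap pi idfun t).
  by rewrite /N /id_D !tmap_comp.
move=> <-; rewrite /D_id; move: (Delta x); apply: tens_ext; [lin|lin|] => a b.
rewrite !tmapE // /coaction; move: (Delta a).
apply: tens_ext; [lin|lin|] => u v.
by rewrite tassocE /N !tmapE // tassocE.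
Qed.

(** Quasi-coassociativity under [id ⊗ id ⊗ pi]; cocentrality turns [pi] on a right leg into the
    swapped [rho], on both sides. *)
Lemma coaction_Delta_r x :
  tmap idfun (fun y => tswap (rho y)) (Delta x) =
  tassoc (tmap Delta idfun (tswap (rho x))).
Proof.
pose N := tmap idfun (tmap idfun pi) : H ⊗ (H ⊗ H) -> H ⊗ (H ⊗ kG).
have lN : linear N by rewrite /N; lin.
have NM s t : N (s * t) = N s * N t.
  by apply: tmapM => [|||a b] //; [lin|apply: tmapM].
have NPhi : N Phi = 1.
  (* On the last leg of [Phi], [pi] is the counit; [Phi_counitr] then applies. *)
  have -> : N Phi = tmap idfun (fun y => y ⊗ zeta k 1%g) (tmap idfun (@counitr k H _) Phi).
    rewrite tmap_comp; [|lin..]; move: (Phi) (gm_Phi gm).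
    apply: tsub_ext; [lin|lin|] => a t _ wt.
    by rewrite /N !tmapE; [rewrite (tmap_pir (tsubT_r wt))|lin..].
  by rewrite Phi_counitr; apply: tmap1 => //; lin.
have := congr1 N (qcoassoc x); rewrite !NM NPhi mul1r mulr1.
have -> t : N (id_D Delta t) = tmap idfun (fun y => tswap (rho y)) t.
  rewrite /N /id_D tmap_comp //; last lin.
  by congr (tmap _ _ t); apply/funext => y; rewrite pi_cocentral.
move=> <-; rewrite -pi_cocentral /D_id; move: (Delta x).
apply: tens_ext; [lin|lin|] => a b.
rewrite !tmapE //; move: (Delta a); apply: tens_ext; [lin|lin|] => u v.
by rewrite /N !tassocE !tmapE //; lin.
Qed.

(** By the two preceding identities, [wproj pi g] on either leg fixes [Delta x]; applying it on both
    legs lands in [W g ⊗ W g]. *)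
Lemma weight_Delta g x : W g x -> tsub (W g) (W g) (Delta x).
Proof.
move=> /coactionE wx.
have left_leg : tmap (wproj pi g) idfun (Delta x) = Delta x.
  have := congr1 (@lcoef k G _ g) (coaction_Delta_l x).
  rewrite wx [tmap idfun _ _]tmapE; [|lin..]; rewrite lcoefE eqxx => e.
  rewrite -[RHS]e; move: (Delta x); apply: tens_ext; [lin|lin|] => a b.
  rewrite !tmapE; [|lin..]; rewrite /wproj; move: (rho a).
  apply: ztens_ext; [lin|lin|] => h v.
  by rewrite tassocE !lcoefE; case: eqP => // _; case: (linP (@tens_linl _ H H b)).
have right_leg : tmap idfun (wproj pi g) (Delta x) = Delta x.
  have := congr1 (tmap idfun (fun t => lcoef g (tswap t))) (coaction_Delta_r x).
  rewrite wx tswapE [tmap Delta _ _]tmapE; [|lin..] => er.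
  transitivity (tmap idfun (fun t => lcoef g (tswap t))
      (tmap idfun (fun y => tswap (rho y)) (Delta x))).
    rewrite tmap_comp //; [|lin..]; congr (tmap _ _ _); apply/funext => y.
    rewrite /wproj; move: (rho y); apply: ztens_ext; [lin|lin|] => h v.
    by rewrite !tswapE.
  rewrite er; move: (Delta x); apply: tens_ext; [lin|lin|] => a b.
  by rewrite tassocE tmapE // ?tswapE ?lcoefE ?eqxx //; lin.
rewrite -left_leg -right_leg tmap_comp; [|lin..].
move: (Delta x); apply: tens_map => [||a b]; [exact: tsub_subspace|lin|].
by rewrite tmapE //; [apply: tsub_tens; exact: wproj_weight|lin..].
Qed.

(** * The image of the Drinfeld twist under [pi], and the antipode on weight spaces *)

Let PhiV1 : tsub (W 1%g) (tsub (W 1%g) (W 1%g)) PhiV.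
Proof.
exact: (graded_inverse3 weight_direct_sum weightM (@qPhiK _ H) (@qPhiVK _ H) (gm_Phi gm)).
Qed.

Let A1 : tsub (W 1%g) (tsub (W 1%g) (tsub (W 1%g) (W 1%g))) (drinfeld_A H).
Proof.
apply: drinfeld_A_sub => //; [exact: weight1| |exact: weight_Delta|exact: gm_Phi].
by move=> x y wx wy; rewrite -[1%g]mulg1; apply: weightM.
Qed.

(** [Theta 1%g PhiV] is the element U of the overview. As a linear map on all of [H ⊗ (H ⊗ H)],
    [Theta g] can be evaluated on both sides of quasi-coassociativity. *)
Let Theta g : H ⊗ (H ⊗ H) -> kG ⊗ H := tlift3 (fun a b c =>
  ((zeta k g^-1%g : kG) ⊗ (S a * qalpha)) * rho (b * qbeta * S c)).

Let Theta_lin g : linear (Theta g).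
Proof. by rewrite /Theta; lin. Qed.

Let ThetaE g a b c : Theta g (a ⊗ (b ⊗ c)) =
  ((zeta k g^-1%g : kG) ⊗ (S a * qalpha)) * rho (b * qbeta * S c).
Proof. by rewrite /Theta tlift3E //; lin. Qed.

Let pi_alpha : pi qalpha = 1 := qhm_alpha (gm_morphism gm).
Let lSk : linear (@qS k kG) := lin_can _.
Let SZ c x : S (c *: x) = c *: S x. Proof. by have [_ _ ->] := linP lS. Qed.
Let rhoZ c x : rho (c *: x) = c *: rho x. Proof. by have [_ _ ->] := linP lrho. Qed.

Let zeta1V : zeta k (1^-1)%g = 1 :> kG.
Proof. by rewrite invg1 zeta1. Qed.

(** The first leg [S(A^2) alpha A^3] is sent by [pi] to the counits of [A^2] and [A^3], and these
    counits reduce [A] to 1. *)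
Lemma tmap_pi_gamma0 : tmap pi idfun (drinfeld_gamma0 H) = 1 ⊗ qalpha.
Proof.
pose J : H ⊗ H -> kG ⊗ H := tlift (fun a b => (1 : kG) ⊗ (S a * qalpha * b)).
have JE a b : J (a ⊗ b) = 1 ⊗ (S a * qalpha * b) by rewrite /J tliftE //; lin.
have lJ : linear J by rewrite /J; lin.
have -> : tmap pi idfun (drinfeld_gamma0 H) =
    J (tmap idfun (fun t => counitl (counitl t)) (drinfeld_A H)).
  rewrite /drinfeld_gamma0 /tlift4; move: (drinfeld_A H) A1.
  have lf (a1 : H) : linear (tlift3 (fun a2 a3 a4 =>
      (S a2 * qalpha * a3) ⊗ (S a1 * qalpha * a4))) by lin.
  apply: tsub_ext => [||a1 t _]; [by rewrite /tlift3; lin|lin|].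
  rewrite tliftE; last by rewrite /tlift3; lin.
  rewrite tmapE; [|lin..]; rewrite JE.
  move: t; apply: tsub_ext3; [lin|lin|] => a2 a3 a4 w2 w3 _.
  rewrite tlift3E; [|lin]; rewrite tmapE //.
  rewrite !piM pi_alpha mulr1 -(qhm_S (gm_morphism gm)).
  rewrite (weight_pi w2) (weight_pi w3).
  have [_ _ ->] := linP lSk; rewrite zeta_S zeta1V -scalerAl mul1r !tensZl.
  by rewrite counitlE counitlZ counitlE -!scalerAr !tensZr zeta1.
(* The second leg is deleted twice: first [tensr1 Phi] becomes 1 and [D_id_id] of [PhiV] becomes
   [PhiV], then [PhiV] becomes 1. *)
have -> : tmap idfun (fun t => counitl (counitl t)) (drinfeld_A H) =
    tmap idfun (@counitl k H _) (tmap idfun (@counitl k H _) (drinfeld_A H)).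
  by rewrite tmap_comp //; lin.
rewrite /drinfeld_A tmapM; [|lin|lin|by []|exact: counitlM].
rewrite counit2_tensr1_Phi counit2_D_id_id mul1r PhiV_counit_mid.
by rewrite [LHS](JE 1 1) qS1 mul1r mulr1.
Qed.

(** For [a] of neutral weight, cocentrality sends [(S ⊗ S)(Delta^cop(a))] to [1 ⊗ S a]; multiplied
    by the image of [gamma_0] this is the left factor of [Theta]. *)
Lemma tmap_pi_twist : tmap pi idfun (drinfeld_twist H) = Theta 1%g PhiV.
Proof.
have lT := Theta_lin 1%g; rewrite /drinfeld_twist; move: (PhiV) PhiV1.
apply: tsub_ext3; [lin|lin|] => a b c wa _ _.
rewrite tlift3E; [|lin]; rewrite ThetaE.
rewrite !tmapM //; rewrite tmap_pi_gamma0 -/(coaction pi _); congr (_ * _).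
have -> : tmap pi idfun (tmap S S (tswap (Delta a))) = 1 ⊗ S a.
  have -> (t : H ⊗ H) : tmap pi idfun (tmap S S t) = tmap qS S (tmap pi idfun t).
    move: t; apply: tens_ext; [lin|lin|] => u v.
    by rewrite !tmapE //; [rewrite (qhm_S (gm_morphism gm))|lin..].
  have -> (t : H ⊗ H) : tmap pi idfun (tswap t) = tswap (tmap idfun pi t).
    move: t; apply: tens_ext; [lin|lin|] => u v.
    by rewrite tswapE !tmapE // tswapE.
  rewrite pi_cocentral (coactionE wa) !tswapE tmapE; [|lin..].
  by rewrite zeta_S zeta1V.
by rewrite tensM mul1r zeta1V.
Qed.

(** The twist f has neutral weight, so its image is [1 ⊗ (eps ⊗ id)(f)]; the counit of
    [Theta 1%g PhiV] is the zigzag expression in [PhiV], which is 1. *)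
Lemma Theta_PhiV : Theta 1%g PhiV = 1.
Proof.
have twE : tmap pi idfun (drinfeld_twist H) = 1 ⊗ counitl (drinfeld_twist H).
  exact: (tmap_pil (tsubT_l (gm_twist gm))).
have tw1 : counitl (drinfeld_twist H) = 1.
  have lT := Theta_lin 1%g; have := congr1 (@counitl k kG H) twE.
  rewrite counitlE eps1 scale1r => <-; rewrite tmap_pi_twist -[RHS](qzigzagV H).
  move: (PhiV); apply: tens_ext3; [lin|lin|] => a b c.
  rewrite ThetaE tlift3E; [|lin].
  by rewrite counitlM counitlE counitl_coaction zeta_eps scale1r !mulrA.
by rewrite -tmap_pi_twist twE tw1.
Qed.

Lemma weight_S g x : W g x -> W g^-1%g (S x).
Proof.
move=> wx; have lT := Theta_lin g; have lT1 := Theta_lin 1%g.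
(* The factor [x_21 beta S(x_22)] contracts to [eps(x_2) beta], which leaves [S x] on the left. *)
have El t : Theta g (t * id_D Delta (Delta x)) =
    ((zeta k g^-1%g : kG) ⊗ S x) * Theta 1%g t.
  move: t; apply: tens_ext3; [lin|lin|] => a b c.
  rewrite -{2}[x]qcounitr -[tlift _ _]/(counitr _) /id_D.
  move: (Delta x); apply: tens_ext; [lin|lin|] => u v.
  rewrite tmapE; [|lin..]; rewrite tensM counitrE.
  have inner (r : H ⊗ H) a' : Theta g (a' ⊗ ((b ⊗ c) * r)) =
      ((zeta k g^-1%g : kG) ⊗ (S a' * qalpha)) *
      rho (b * tlift (fun p q => p * qbeta * S q) r * S c).
    move: r; apply: tens_ext; [lin|lin|] => p q.
    by rewrite tensM ThetaE tliftE ?qSM ?mulrA //; lin.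
  rewrite inner qantipr qSM ThetaE zeta1V.
  rewrite -scalerAr -scalerAl rhoZ SZ tensZr -scalerAl -scalerAr; congr (_ *: _).
  by rewrite mulrA tensM mulr1 mulrA.
(* As [x_12] has weight [g], its coaction supplies a [zeta k g] cancelling the inverse one; then
   [S(x_11) alpha x_12] contracts to [eps(x_1) alpha]. *)
have Er t : Theta g (D_id Delta (Delta x) * t) = Theta 1%g t * rho (S x).
  move: t; apply: tens_ext3; [lin|lin|] => a b c.
  rewrite -[in RHS](qcounitl x) -[tlift _ _]/(counitl _) /D_id.
  move: (Delta x) (weight_Delta wx); apply: tsub_ext; [lin|lin|] => u v wu _.
  rewrite tmapE; [|lin..]; rewrite counitlE.
  have inner r : tsub (W g) (W g) r -> Theta g (tassoc (r ⊗ v) * (a ⊗ (b ⊗ c))) =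
      ((1 : kG) ⊗ (S a * tlift (fun p q => S p * qalpha * q) r)) *
      rho (b * qbeta * S c) * rho (S v).
    move: r; apply: tsub_ext; [lin|lin|] => p q _ wq.
    rewrite tassocE !tensM ThetaE tliftE; last lin.
    rewrite !qSM -!mulrA -coactionM (coactionM q) (coactionE wq) mulrA tensM.
    by rewrite zeta_mul mulVg zeta1 !mulrA.
  rewrite (inner _ (weight_Delta wu)) qantipl ThetaE zeta1V.
  by rewrite -scalerAr tensZr -!scalerAl SZ rhoZ -scalerAr.
(* Equates the arguments of [Theta g] in [El] and [Er] at [t = PhiV]. *)
have coassocV : PhiV * id_D Delta (Delta x) = D_id Delta (Delta x) * PhiV.
  rewrite -[RHS]mul1r -(@qPhiVK _ H) -mulrA (mulrA Phi) qcoassoc -!mulrA.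
  by rewrite qPhiK mulr1.
have := El PhiV; rewrite coassocV Er Theta_PhiV mul1r mulr1 => e.
by change (rho (S x) = zeta k g^-1%g ⊗ S x); rewrite e.
Qed.

Lemma morphism_to_grading : is_grading W.
Proof.
split; [exact: weight_direct_sum|exact: weightM|exact: weight_Delta|exact: weight_S|..].
- exact: gm_Phi.
- exact: gm_alpha.
exact: gm_beta.
Qed.

Lemma morphism_to_faithful : faithful W.
Proof. exact: weight_nonzero. Qed.

End MorphismToGrading.

Theorem theorem3p5 (k : fieldType) (G : groupType) (H : quasiHopf k) :
  exists (to_morphism : faithful_grading G H -> grading_morphism G H)
         (to_grading : grading_morphism G H -> faithful_grading G H),
  [/\ forall (F : faithful_grading G H) (g : G) (x : H),
        sval F g x -> sval (to_morphism F) x = qeps x *: zeta k g,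
      forall (p : grading_morphism G H) (g : G),
        sval (to_grading p) g = weight_space (sval p) g,
      cancel to_morphism to_grading
    & cancel to_grading to_morphism].
Proof.
have sval_inj T (P : T -> Prop) (a b : {x | P x}) : sval a = sval b -> a = b.
  by case: a b => [a pa] [b pb] /= ab; exact: eq_exist.
(* [cid] selects a morphism from the existence statement, together with its formula on the
   components. *)
have morphism_of (F : faithful_grading G H) : {p : grading_morphism G H |
    forall g x, sval F g x -> sval p x = qeps x *: zeta k g}.
  apply: cid; case: F => F [gF fF].
  have [pi [lpi piE]] := grading_ex_morphism gF.
  by exists (exist _ pi (grading_to_morphism gF lpi piE fF)).
pose to_grading (p : grading_morphism G H) : faithful_grading G H :=
  exist _ (weight_space (sval p))
    (conj (morphism_to_grading (svalP p)) (morphism_to_faithful (svalP p))).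
exists (fun F => sval (morphism_of F)), to_grading; split=> //.
- by move=> F; exact: (svalP (morphism_of F)).
- move=> F; apply: sval_inj => /=; case: (morphism_of F) => p pE /=.
  have [gF _] := svalP F.
  exact: (grading_weight_space gF (qhm_linear (gm_morphism (svalP p))) pE).
(* Both morphisms are given by the same formula on the weight spaces of [p], which span [H]. *)
move=> p; case: (morphism_of _) => q /= qE; apply: sval_inj; apply/funext.
apply: (dsum_ext (weight_direct_sum (svalP p))).
- exact: (qhm_linear (gm_morphism (svalP q))).
- exact: (qhm_linear (gm_morphism (svalP p))).
by move=> g x wx; rewrite (qE g x wx) (weight_pi (svalP p) wx).
Qed.
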